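(* Let $n$, $m$, $\mu$, $\lambda$ and $k$ be positive integers such that (i) $\mu>\lambda$ and $m\ge n-1$; or (ii) $\lambda=1$, $\mu=2$ and $m=n-2$; or (iii) $\mu>\lambda$, $n=3$ and $m=1$. Then a strong path decomposition $\mathcal{A}$ of $\lambda K_n$ of size $k$ can be enclosed in a Hamiltonian decomposition of $\mu K_{n+m}$ if and only if all of the following hold: (M1) $k=\frac{\mu(m+n-1)}{2}$; (M2) $\sum_{i=0}^{n-m}(n-m-i)\,|\mathcal{S}_i(\mathcal{A})|\le(\mu-\lambda)\frac{n(n-1)}{2}$ (an empty sum is $0$); (M3) if (ii) or (iii) holds, then for every pair of distinct vertices $u,v$ of $K_n$, $|\mathcal{S}_1(u,v,\mathcal{A})|\le(\mu-\lambda)\left(\frac{n(n-1)}{2}-1\right)-|\mathcal{S}_0(\mathcal{A})|$.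
   Context: Graphs may have multiple edges. For a positive integer $\lambda$, $\lambda K_n$ is the loopless multigraph on $n$ vertices in which every pair of distinct vertices is joined by exactly $\lambda$ edges. A decomposition of size $k$ of a graph $G$ is an ordered $k$-tuple $(G(1),\dots,G(k))$ of spanning subgraphs of $G$ (called colour classes; a colour class may have no edges) whose edge sets are pairwise disjoint with union $E(G)$. A path decomposition is a decomposition in which every colour class is a vertex-disjoint union of paths and cycles (isolated vertices count as trivial paths; two parallel edges form a cycle of length 2); it is strong if no colour class contains a cycle (including cycles of length 2). A Hamiltonian decomposition is a decomposition in which every colour class is a Hamiltonian cycle. For $\mu>\lambda$, a decomposition $(G(1),\dots,G(k))$ of $\lambda K_n$ is enclosed in a decomposition $(H(1),\dots,H(k))$ of $\mu K_{n+m}$ (where $\lambda K_n$ is regarded as a subgraph of $\mu K_{n+m}$ on $n$ of its vertices) if $G(i)\subseteq H(i)$ for every $i$. For a decomposition $\mathcal{A}$, $\mathcal{S}_i(\mathcal{A})$ is the set of colour classes of $\mathcal{A}$ with exactly $i$ edges, and for distinct vertices $u,v$, $\mathcal{S}_1(u,v,\mathcal{A})$ is the set of colour classes in $\mathcal{S}_1(\mathcal{A})$ whose single edge joins $u$ and $v$. *)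

(* Defs.v *)
From mathcomp Require Import all_boot all_order all_algebra.
Set Implicit Arguments. Unset Strict Implicit. Unset Printing Implicit Defensive.
Import GRing.Theory Num.Theory.

(* A loopless multigraph on vertex set 'I_N is given by its edge-multiplicity
   function G u v (number of edges joining u and v). *)
Definition mgraph (N : nat) := 'I_N -> 'I_N -> nat.

Definition is_mgraph N (G : mgraph N) : Prop :=
  (forall u v, G u v = G v u) /\ (forall u, G u u = 0).

Definition nedges N (G : mgraph N) : nat :=
  \sum_(u < N) \sum_(v < N | (u < v)%N) G u v.

Definition decomposition N k (lam : nat) (D : 'I_k -> mgraph N) : Prop :=
  (forall i, is_mgraph (D i)) /\
  (forall u v : 'I_N, u != v -> \sum_(i < k) D i u v = lam).

Definition pcount N (ps : seq ('I_N * 'I_N)) (u v : 'I_N) : nat :=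
  count (fun p => ((p.1 == u) && (p.2 == v)) || ((p.1 == v) && (p.2 == u))) ps.

Definition path_pairs N (s : seq 'I_N) := zip s (behead s).
Definition cycle_pairs N (s : seq 'I_N) := zip s (rot 1 s).

(* G is a vertex-disjoint union of paths (no cycles); vertices not listed
   are trivial paths *)
Definition linear_forest N (G : mgraph N) : Prop :=
  is_mgraph G /\
  exists P : seq (seq 'I_N), uniq (flatten P) /\
    forall u v, u != v -> G u v = \sum_(p <- P) pcount (path_pairs p) u v.

(* G is a Hamiltonian cycle: a cycle through all N vertices (N >= 2; for
   N = 2 this is the 2-cycle formed by two parallel edges) *)
Definition ham_cycle N (G : mgraph N) : Prop :=
  is_mgraph G /\ (2 <= N)%N /\
  exists s : seq 'I_N, perm_eq s (enum 'I_N) /\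
    forall u v, u != v -> G u v = pcount (cycle_pairs s) u v.

Definition strong_path_decomposition N k lam (D : 'I_k -> mgraph N) : Prop :=
  decomposition lam D /\ forall i, linear_forest (D i).

Definition ham_decomposition N k mu (H : 'I_k -> mgraph N) : Prop :=
  decomposition mu H /\ forall i, ham_cycle (H i).

Definition enclosable_ham n m k mu (A : 'I_k -> mgraph n) : Prop :=
  exists H : 'I_k -> mgraph (n + m),
    ham_decomposition mu H /\
    forall i u v, (A i u v <= H i (lshift m u) (lshift m v))%N.

Definition S_card N k (A : 'I_k -> mgraph N) (j : nat) : nat :=
  #|[set i : 'I_k | nedges (A i) == j]|.

Definition S1_card N k (A : 'I_k -> mgraph N) (u v : 'I_N) : nat :=
  #|[set i : 'I_k | (nedges (A i) == 1%N) && (A i u v == 1%N)]|.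

(* Main.v *)
Require Import Defs.
From mathcomp Require Import all_boot all_order all_algebra zify.
Import GRing.Theory Num.Theory.
Set Implicit Arguments.
Unset Strict Implicit.
Unset Printing Implicit Defensive.

(* Sufficiency has two steps. First, the (mu - lam) 'C(n, 2) missing edges of mu K_n
   are distributed over the colour classes so that every class stays a union of
   paths and gets at least n - m edges, i.e. has at most m components. An edge uv
   fits into a class unless the free ends of u and v in it number at most two, so
   counting free ends shows that a greedy choice works when m >= n - 1; for
   m = n - 2 it can only get stuck at the very end, and the last two edges, chosen
   adjacent, can then be placed together; n = 3, m = 1 is a Hall-type argument.
   Second, the m new vertices are added one at a time: if each class has m paths
   (some possibly empty), a regular factor of an auxiliary bipartite multigraph tells
   which two paths of each class the new vertex links, leaving m - 1 paths; the
   last vertex closes each remaining path into a Hamiltonian cycle.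
   Necessity counts edges, using that a Hamiltonian cycle of K_{n+m} leaves at least
   n - m edges on n vertices. *)

(** * Edge multiplicities of families of paths *)

(** Free ends are the common currency. Since [k.*2 = mu * (m + n - 1)], the free ends of a vertex,
    summed over the classes, are exactly as many as the edges it still has to receive; so adding a
    vertex amounts to finding a factor with prescribed degrees. The obstacle is that the two ends
    chosen in a class must lie on different paths, or a short cycle closes. The thresholds on m come
    from the same count. An edge uv can be blocked in all classes only if the degrees of u and v,
    summed over the classes, add up to at least 2k. While a copy of uv is missing they add up to at
    most 2 mu (n - 1) - 2, which is below 2k when m >= n - 1. When mu = 2 and m = n - 2, 2k is 4n -
    6 while the full sum is 4n - 4, so a third unit must be missing: another missing edge at u or v.
    Hence the missing edges are taken in an order in which each one meets a later one. Condition
    (M3) reflects that a class consisting of uv alone cannot receive another copy of uv, and that an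
    empty class, which needs two edges, can receive only one. *)

Section Paths.
Variable N : nat.
Implicit Types (p q : seq 'I_N) (P Q : seq (seq 'I_N)) (u v x y : 'I_N).

Definition edge_ind x y u v : nat :=
  ((x == u) && (y == v)) || ((x == v) && (y == u)).

(** The ends of an empty path are [None] and link to nothing; this lets empty paths pad every class
    to a prescribed number of paths. *)
Definition link (a b : option 'I_N) u v : nat :=
  if a is Some x then if b is Some y then edge_ind x y u v else 0 else 0.

Definition pmult p u v := pcount (path_pairs p) u v.

Definition mult P u v : nat := \sum_(p <- P) pmult p u v.

(* An isolated vertex counts as both ends of its path, so that [ends P v] is 2 minus
   the degree of v. *)
Definition ends P v : nat :=
  \sum_(p <- P) ((ohead p == Some v) + (ohead (rev p) == Some v)).

Definition size_edges P : nat := \sum_(p <- P) (size p).-1.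

Lemma edge_indC x y u v : edge_ind x y u v = edge_ind y x u v.
Proof. by rewrite /edge_ind orbC; congr (nat_of_bool (_ || _)); rewrite andbC. Qed.

Lemma pcountC (ps : seq ('I_N * 'I_N)) u v : pcount ps u v = pcount ps v u.
Proof. by apply: eq_count => e /=; rewrite orbC. Qed.

Lemma multC P u v : mult P u v = mult P v u.
Proof. by apply: eq_bigr => p _; exact: pcountC. Qed.

Lemma pcount_cons (e : 'I_N * 'I_N) ps u v :
  pcount (e :: ps) u v = edge_ind e.1 e.2 u v + pcount ps u v.
Proof. by []. Qed.

Lemma pmult_cons x p u v :
  pmult (x :: p) u v = link (Some x) (ohead p) u v + pmult p u v.
Proof. by case: p => [|y p]. Qed.

Lemma ohead_rev_cons x p :
  ohead (rev (x :: p)) = if p is [::] then Some x else ohead (rev p).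
Proof.
case: p => [|y p] //; rewrite [rev (x :: _)]rev_cons.
by case: (rev (y :: p)) (size_rev (y :: p)).
Qed.

Lemma pmult_cat p q u v :
  pmult (p ++ q) u v =
  pmult p u v + link (ohead (rev p)) (ohead q) u v + pmult q u v.
Proof.
elim: p => [|x p IH] //=; rewrite !pmult_cons IH ohead_rev_cons.
by case: p {IH} => [|y p] /=; rewrite ?addn0 ?addnA.
Qed.

Lemma linkC a b u v : link a b u v = link b a u v.
Proof. by case: a; case: b => //= x y; rewrite edge_indC. Qed.

Lemma link_end a x v : v != x -> link a (Some x) x v = (a == Some v).
Proof.
move=> vx; case: a => [y|] //=.
rewrite /edge_ind eqxx [x == v]eq_sym (negPf vx) andbF andbT /=.
by congr (nat_of_bool _).
Qed.

Lemma link_away a x u v : u != x -> v != x -> link a (Some x) u v = 0.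
Proof.
move=> ux vx; case: a => //= y.
by rewrite /edge_ind ![x == _]eq_sym (negPf ux) (negPf vx) !andbF.
Qed.

Lemma pmult_rev p u v : pmult (rev p) u v = pmult p u v.
Proof.
elim: p => // x p IH; rewrite rev_cons -cats1 pmult_cat IH revK linkC [RHS]pmult_cons.
by rewrite /pmult /path_pairs /= addn0 addnC.
Qed.

Lemma mult_cons p P u v : mult (p :: P) u v = pmult p u v + mult P u v.
Proof. by rewrite /mult big_cons. Qed.

Lemma mult_perm P Q u v : perm_eq P Q -> mult P u v = mult Q u v.
Proof. exact: perm_big. Qed.

Lemma edge_ind_deg x y v : x != y ->
  \sum_(u < N) edge_ind x y v u = (x == v) + (y == v).
Proof.
move=> xy.
have sum1 z : \sum_(u < N) (z == u) = 1.
  by rewrite (bigD1 z) //= eqxx big1 // => u uz; rewrite eq_sym (negPf uz).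
rewrite (eq_bigr (fun u => (x == v) * (y == u) + (y == v) * (x == u))).
  by rewrite big_split /= -!big_distrr /= !sum1 !muln1.
move=> u _; rewrite /edge_ind.
case: (eqVneq x v) => [<-|nx]; last by case: (x == u); case: (y == v).
by rewrite [y == x]eq_sym (negPf xy) andbF orbF; case: (y == u).
Qed.

Lemma pmult_deg p v :
  uniq p ->
  \sum_(u < N) pmult p v u + ((ohead p == Some v) + (ohead (rev p) == Some v))
    = (count_mem v p).*2.
Proof.
elim: p => [_|x p IH].
  by rewrite big1.
move=> /= /andP[xp /IH {}IH].
under eq_bigr do rewrite pmult_cons.
rewrite big_split /= ohead_rev_cons.
case: p xp IH => [|y p] xp IH.
  by rewrite !big1 //= !addn0 addnn -muln2 add0n; congr (_ * _).
have xy : x != y by apply: contraNneq xp => ->; rewrite mem_head.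
have -> : \sum_(u < N) link (Some x) (ohead (y :: p)) v u = (x == v) + (y == v).
  exact: edge_ind_deg.
move: IH; rewrite -[Some x == Some v]/(x == v) -[ohead _ == _]/(y == v) doubleD.
set S := \sum_(_ < _) _; set O := (ohead (rev _) == _).
by case: (x == v); case: (y == v) => /=; lia.
Qed.

Lemma mult_deg P v : uniq (flatten P) ->
  \sum_(u < N) mult P v u + ends P v = (count_mem v (flatten P)).*2.
Proof.
elim: P => [|p P IH] /=; first by rewrite /mult /ends big1 ?big_nil // => i; rewrite big_nil.
rewrite cat_uniq => /and3P[up _ /IH {}IH].
under eq_bigr do rewrite mult_cons.
rewrite big_split /= /ends big_cons -/(ends P v) count_cat doubleD -IH -(pmult_deg v up).
by rewrite addnACA.
Qed.

Lemma pmult_diag p v : uniq p -> pmult p v v = 0.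
Proof.
elim: p => // x [|y p] IH // /andP[xp up].
rewrite pmult_cons IH // /= /edge_ind orbb addn0.
case: eqP => //= <-; case: eqP => //= yx.
by rewrite -yx mem_head in xp.
Qed.

Lemma mult_diag P v : uniq (flatten P) -> mult P v v = 0.
Proof.
elim: P => [|p P IH] /=; first by rewrite /mult big_nil.
by rewrite cat_uniq mult_cons => /and3P[up _ /IH ->]; rewrite pmult_diag.
Qed.

Lemma pmult_notin p u v : u \notin p -> pmult p u v = 0.
Proof.
elim: p => // x p IH; rewrite inE negb_or eq_sym => /andP[ux up].
rewrite pmult_cons IH // addn0; case: p up {IH} => //= y p.
rewrite inE negb_or eq_sym => /andP[uy _].
by rewrite /edge_ind (negPf ux) (negPf uy) andbF.
Qed.

Lemma mult_notin P u v : u \notin flatten P -> mult P u v = 0.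
Proof.
move=> h; rewrite /mult big1_seq // => p /andP[_ pP]; apply: pmult_notin.
by apply: contra h => up; apply/flattenP; exists p.
Qed.

Lemma edge_ind_sum x y : x != y ->
  \sum_(u < N) \sum_(v < N | u < v) edge_ind x y u v = 1.
Proof.
move=> xy; wlog lxy : x y xy / x < y.
  move=> H; case: (ltngtP x y) (xy) => [h _|h _|/val_inj ->]; last by rewrite eqxx.
    exact: H.
  by under eq_bigr do under eq_bigr do rewrite edge_indC; apply: H => //; rewrite eq_sym.
rewrite (bigD1 x) //= (bigD1 y) //= big1 => [|v /andP[_ vy]]; last first.
  rewrite /edge_ind eqxx [y == v]eq_sym (negPf vy) /= [y == x]eq_sym (negPf xy).
  by rewrite andbF.
rewrite big1 => [|u ux]; first by rewrite /edge_ind !eqxx.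
rewrite big1 // => v uv; rewrite /edge_ind eq_sym (negPf ux) /=.
case: eqP => // xv; case: eqP => // yu.
by move: uv lxy; rewrite xv yu; lia.
Qed.

Lemma pcount_sum (ps : seq ('I_N * 'I_N)) : all (fun e => e.1 != e.2) ps ->
  \sum_(u < N) \sum_(v < N | u < v) pcount ps u v = size ps.
Proof.
elim: ps => [_|e ps IH] /=; first by rewrite big1 // => u _; rewrite big1.
move=> /andP[he /IH {}IH].
under eq_bigr do rewrite big_split /=.
rewrite big_split /= IH -add1n; congr (_ + _); exact: edge_ind_sum.
Qed.

Lemma path_pairs_neq p : uniq p -> all (fun e => e.1 != e.2) (path_pairs p).
Proof.
elim: p => // x [|y p] IH // /andP[xp up] /=.
apply/andP; split; last exact: IH.
by apply: contraNneq xp => ->; rewrite mem_head.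
Qed.

Lemma mult_sum P : uniq (flatten P) ->
  \sum_(u < N) \sum_(v < N | u < v) mult P u v = size_edges P.
Proof.
elim: P => [_|p P IH] /=.
  by rewrite /size_edges big_nil big1 // => u _; rewrite big1 // => v _; rewrite /mult big_nil.
rewrite cat_uniq => /and3P[up _ /IH {}IH].
under eq_bigr do under eq_bigr do rewrite mult_cons.
under eq_bigr do rewrite big_split /=.
rewrite big_split /= IH pcount_sum ?path_pairs_neq // /size_edges big_cons.
by congr (_ + _); rewrite /path_pairs size_zip size_behead; lia.
Qed.

(** Euler's relation for forests: it turns a lower bound on edges into an upper bound on the number
    of nonempty paths. *)
Lemma size_edges_nonempty P :
  size_edges P + size [seq p <- P | p != [::]] = size (flatten P).
Proof.
rewrite /size_edges; elim: P => [|p P IH]; first by rewrite big_nil.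
rewrite big_cons /= size_cat -IH; case: p => //= x p; lia.
Qed.

End Paths.

(** * Equitable colourings of bipartite multigraphs *)

(** Two perfect matchings on E form a union of even cycles. Each cycle splits into two orbits of
    [p], exchanged by [s]; comparing the ranks of their roots colours one of them. The orbits differ
    because a [p]-path from [e] to [s e] shortens by two steps at a time to a fixed point of [s] or
    [t]. *)
Lemma two_involutions_bicolouring (E : finType) (s t : E -> E) :
  involutive s -> involutive t ->
  (forall e, s e != e) -> (forall e, t e != e) ->
  exists c : E -> bool, (forall e, c (s e) = ~~ c e) /\ (forall e, c (t e) = ~~ c e).
Proof.
move=> sK tK sF tF.
pose p e := s (t e).
have p_inj : injective p by move=> x y /(inv_inj sK) /(inv_inj tK).
have noconn n e : iter n p e != s e.
  have [q] := ubnP n; elim: q n e => // q IH [|[|n]] e; rewrite ?ltnS => lt_n.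
  - by rewrite /= eq_sym.
  - by rewrite /= /p (inj_eq (inv_inj sK)).
  - rewrite iterSr iterS /p (inj_eq (inv_inj sK)) -(inj_eq (inv_inj tK)) tK.
    by have := IH n (p e) (ltnW lt_n); rewrite /p sK.
have psym := fconnect_sym p_inj.
have rootE x y : reflect (froot p x = froot p y) (fconnect p x y).
  exact: (fingraph.rootP psym).
have root_p e : froot p (p e) = froot p e.
  by apply/rootE; rewrite psym; exact: fconnect1.
have root_sp e : froot p (s (p e)) = froot p (s e).
  have <- : p (s (p e)) = s e by rewrite /p sK tK.
  exact: esym (root_p _).
pose c e := enum_rank (froot p e) < enum_rank (froot p (s e)).
have cs e : c (s e) = ~~ c e.
  rewrite /c sK -leqNgt [RHS]leq_eqVlt; case: eqP => // /val_inj /enum_rank_inj.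
  move=> /rootE; rewrite psym => /iter_findex h.
  by have := noconn (findex p e (s e)) e; rewrite h eqxx.
exists c; split=> // e; rewrite -[t e]sK cs; congr (~~ _).
by rewrite -/(p e) /c root_p root_sp.
Qed.

Lemma fibre_pairing (E : finType) (L : eqType) (l : E -> L) :
  exists s : E -> E, [/\ involutive s, forall e, l (s e) = l e &
    forall e e', l e = l e' -> s e = e -> s e' = e' -> e = e'].
Proof.
pose fib x := [seq e <- enum E | l e == x].
have fibE e x : (e \in fib x) = (l e == x) by rewrite mem_filter mem_enum andbT.
have ufib x : uniq (fib x) by rewrite filter_uniq ?enum_uniq.
pose sw j := if odd j then j.-1 else j.+1.
have swK j : sw (sw j) = j.
  by rewrite /sw; case: (boolP (odd j)) => oj; case: ifP; lia.
(* Positions 0-1, 2-3, ... of a fibre are swapped; the default [e] makes the last element of an odd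
   fibre a fixed point. *)
pose s e := nth e (fib (l e)) (sw (index e (fib (l e)))).
have ls e : l (s e) = l e.
  rewrite /s; case: (ltnP (sw (index e (fib (l e)))) (size (fib (l e)))) => h.
    by apply/eqP; rewrite -fibE mem_nth.
  by rewrite nth_default.
exists s; split=> // [e | e e' ll].
  set F := fib (l e); have eF : e \in F by rewrite fibE.
  set j := index e F; have jlt : j < size F by rewrite index_mem.
  have [h|h] := ltnP (sw j) (size F).
    have sE : s e = nth e F (sw j) by [].
    have iE : index (s e) F = sw j by rewrite sE index_uniq // ufib.
    by rewrite [LHS]/s ls -/F iE swK (set_nth_default e) // nth_index.
  have sE : s e = e by rewrite /s nth_default.
  by rewrite !sE.
rewrite /s -ll; set F := fib (l e).
have eF : e \in F by rewrite fibE.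
have eF' : e' \in F by rewrite fibE ll.
have key x : x \in F -> nth x F (sw (index x F)) = x -> index x F = (size F).-1.
  move=> xF; have xl : index x F < size F by rewrite index_mem.
  have [h|h _] := ltnP (sw (index x F)) (size F).
    move=> /(congr1 (index ^~ F)); rewrite index_uniq ?ufib //.
    by rewrite /sw; move: (index x F) => j; case: (boolP (odd j)) => oj; lia.
  move: h xl; rewrite /sw; move: (index x F) => j.
  by case: (boolP (odd j)) => oj; lia.
move=> /(key _ eF) h1 /(key _ eF') h2.
by rewrite -(nth_index e eF) -(nth_index e eF') h1 h2.
Qed.

(** The pairing injects the elements of one colour into those of the other within the fibre, except
    for its fixed point, of which there is at most one. *)
Lemma pairing_balanced (E : finType) (L : eqType) (l : E -> L) (s : E -> E)
    (c : E -> bool) (x : L) (b : bool) :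
  involutive s -> (forall e, l (s e) = l e) ->
  (forall e e', l e = l e' -> s e = e -> s e' = e' -> e = e') ->
  (forall e, s e != e -> c (s e) = ~~ c e) ->
  #|[set e | (l e == x) && (c e == b)]|
    <= #|[set e | (l e == x) && (c e == ~~ b)]|.+1.
Proof.
move=> sK ls fixu cs.
set A := [set e | _]; set B := [set e | _].
pose Fx := [set e in A | s e == e].
have cardF : #|Fx| <= 1.
  apply/card_le1_eqP => e e'; rewrite !inE => /andP[/andP[/eqP h1 _] /eqP h2].
  by move=> /andP[/andP[/eqP h3 _] /eqP h4]; apply: fixu; rewrite ?h1.
have cardD : #|A :\: Fx| <= #|B|.
  rewrite -(card_imset _ (inv_inj sK)); apply/subset_leq_card/subsetP => y.
  move=> /imsetP[e]; rewrite !inE => /andP[h1 /andP[h2 h3]] ->.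
  by rewrite h2 h3 andbT in h1; rewrite ls h2 cs // (eqP h3) eqxx.
have : #|A| <= #|A :\: Fx| + #|Fx|.
  by rewrite -cardsUI; apply: leq_trans (leq_addr _ _); apply/subset_leq_card/subsetP => e;
     rewrite !inE; case: (s e == e); rewrite ?andbT ?andbF ?orbT ?orbF //=; move=> ->.
lia.
Qed.

(** E is the edge set of a bipartite multigraph; pairing the edges at each vertex plays the part of
    an Eulerian tour coloured alternately. *)
Lemma balanced_halving (E : finType) (L R : eqType) (l : E -> L) (r : E -> R) :
  exists c : E -> bool, forall b,
    (forall x, #|[set e | (l e == x) && (c e == b)]|
                 <= #|[set e | (l e == x) && (c e == ~~ b)]|.+1) /\
    (forall y, #|[set e | (r e == y) && (c e == b)]|
                 <= #|[set e | (r e == y) && (c e == ~~ b)]|.+1).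
Proof.
have [s [sK ls sfix]] := fibre_pairing l.
have [t [tK rt tfix]] := fibre_pairing r.
(* Doubling E removes the fixed points of the two pairings. *)
pose dbl (f : E -> E) (z : E * bool) :=
  if f z.1 == z.1 then (z.1, ~~ z.2) else (f z.1, z.2).
have dblK f : involutive f -> involutive (dbl f).
  move=> fK [e b]; rewrite /dbl /=; case: (eqVneq (f e) e) => h /=.
    by rewrite h eqxx negbK.
  by rewrite fK eq_sym (negPf h).
have dblF f z : dbl f z != z.
  case: z => e b; rewrite /dbl /=; case: (eqVneq (f e) e) => h; rewrite xpair_eqE.
    by rewrite eqxx /=; case: b.
  by rewrite (negPf h).
have [c [cs ct]] :=
  two_involutions_bicolouring (dblK s sK) (dblK t tK) (dblF s) (dblF t).
exists (fun e => c (e, false)) => b; split=> x.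
  apply: (pairing_balanced x b sK ls sfix) => e h.
  by rewrite -cs /dbl /= (negPf h).
apply: (pairing_balanced x b tK rt tfix) => e h.
by rewrite -ct /dbl /= (negPf h).
Qed.

Definition incident (E : finType) (L R : eqType) (l : E -> L) (r : E -> R)
    (v : L + R) (e : E) :=
  match v with inl x => l e == x | inr y => r e == y end.

(** Convexity: among splittings of a fixed sum the balanced one has the least sum of squares,
    strictly less than one with a gap of at least two. *)
Lemma balanced_squares p q p' q' :
  p + q = p' + q' -> p <= q.+1 -> q <= p.+1 ->
  p ^ 2 + q ^ 2 <= p' ^ 2 + q' ^ 2 /\
  (q'.+1 < p' -> p ^ 2 + q ^ 2 < p' ^ 2 + q' ^ 2).
Proof.
rewrite -!mulnn => e h1 h2; have [le|lt] := leqP p p'.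
  have [s sE] : exists s, p' = p + s by exists (p' - p); lia.
  have qE : q = q' + s by lia.
  subst p' q; split.
    have : q' * s <= p * s by rewrite leq_mul2r; lia.
    lia.
  move=> h; have : q' * s < p * s by rewrite ltn_mul2r; lia.
  lia.
have [s sE] : exists s, p = p' + s by exists (p - p'); lia.
have qE : q' = q + s by lia.
subst p q'; split; last lia.
have : p' * s <= q * s by rewrite leq_mul2r; lia.
lia.
Qed.

(** De Werra's theorem on equitable edge colourings. If colours a and b differ by more than one at
    v, halving the edges of these two colours afresh lowers the sum of squares at v and raises it at
    no vertex. *)
Lemma equitable_colouring (E L R : finType) (l : E -> L) (r : E -> R) (m : nat) :
  0 < m ->
  exists col : E -> 'I_m, forall (v : L + R) (a b : 'I_m),
    #|[set e | incident l r v e & col e == a]|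
      <= #|[set e | incident l r v e & col e == b]|.+1.
Proof.
case: m => // m _.
pose d (col : {ffun E -> 'I_m.+1}) (v : L + R) a :=
  #|[set e | incident l r v e & col e == a]|.
(* At a minimum of the sum of squares, no two colours can be rebalanced at any vertex. *)
pose Phi col := \sum_v \sum_a d col v a ^ 2.
pose col := [arg min_(col < [ffun=> ord0]) Phi col].
have minP col' : Phi col <= Phi col'.
  by rewrite /col; case: arg_minnP => // c _ ->.
exists col => v a b; rewrite leqNgt; apply/negP => viol.
have ab : a != b by apply: contraTneq viol => ->; rewrite -leqNgt ltnW.
pose ina e := (col e == a) || (col e == b).
(* The flag [ina e] separates the edges of the two colours at a vertex from the others, so they are
   balanced among themselves. *)
have [c balc] := balanced_halving (fun e => (l e, ina e)) (fun e => (r e, ina e)).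
pose col' := [ffun e => if ina e then (if c e then a else b) else col e].
have bal w : d col' w a + d col' w b = d col w a + d col w b /\
   (d col' w a <= (d col' w b).+1 /\ d col' w b <= (d col' w a).+1).
  have E1 : d col' w a = #|[set e | incident l r w e && ina e && (c e == true)]|.
    apply: eq_card => e; rewrite !inE ffunE -andbA; congr (_ && _).
    rewrite /ina; case: (eqVneq (col e) a) => [->|ha] /=.
      by case: (c e); rewrite ?eqxx // eq_sym (negPf ab).
    case: (eqVneq (col e) b) => [hb|hb] //=; last by rewrite (negPf ha).
    by case: (c e); rewrite ?eqxx // eq_sym (negPf ab).
  have E2 : d col' w b = #|[set e | incident l r w e && ina e && (c e == false)]|.
    apply: eq_card => e; rewrite !inE ffunE -andbA; congr (_ && _).
    rewrite /ina; case: (eqVneq (col e) a) => [->|ha] /=.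
      by case: (c e); rewrite ?eqxx // (negPf ab).
    case: (eqVneq (col e) b) => [hb|hb] //=; last by rewrite (negPf hb).
    by case: (c e); rewrite ?eqxx // (negPf ab).
  split.
    rewrite E1 E2 /d -[LHS]cardsUI -[RHS]cardsUI.
    congr (_ + _); apply: eq_card => e; rewrite !inE /ina.
      by case: (incident l r w e) => //=; case: (col e == a); case: (col e == b); case: (c e).
    case: (incident l r w e) => //=.
    case: (eqVneq (col e) a) => [->|ha]; rewrite ?(negPf ab) /=; first by case: (c e).
    by case: (c e); rewrite ?andbF.
  have [hL hR] := (fun z => proj1 (balc z), fun z => proj2 (balc z)).
  rewrite E1 E2; case: w {E1 E2} => z /=.
    have eqs b' : #|[set e | (l e == z) && ina e && (c e == b')]| =
        #|[set e | ((l e, ina e) == (z, true)) && (c e == b')]|.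
      by apply: eq_card => e; rewrite !inE xpair_eqE eqb_id.
    by rewrite !eqs; split; [exact: (hL true)|exact: (hL false)].
  have eqs b' : #|[set e | (r e == z) && ina e && (c e == b')]| =
      #|[set e | ((r e, ina e) == (z, true)) && (c e == b')]|.
    by apply: eq_card => e; rewrite !inE xpair_eqE eqb_id.
  by rewrite !eqs; split; [exact: (hR true)|exact: (hR false)].
have other w a' : a' != a -> a' != b -> d col' w a' = d col w a'.
  rewrite ![a' == _]eq_sym => /negPf ha /negPf hb.
  apply: eq_card => e; rewrite !inE ffunE /ina; congr (_ && _).
  case: (eqVneq (col e) a) => [->|h1] /=; first by case: (c e); rewrite ha ?hb.
  by case: (eqVneq (col e) b) => [h2|h2] //=; case: (c e); rewrite h2 hb ?ha.
have split2 cl w : \sum_a' d cl w a' ^ 2 = d cl w a ^ 2 + (d cl w b ^ 2 +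
    \sum_(a' | (a' != a) && (a' != b)) d cl w a' ^ 2).
  by rewrite (bigD1 a) //= (bigD1 b) 1?eq_sym.
have rest w : \sum_(a' | (a' != a) && (a' != b)) d col' w a' ^ 2 =
  \sum_(a' | (a' != a) && (a' != b)) d col w a' ^ 2.
  by apply: eq_bigr => a' /andP[h1 h2]; rewrite other.
have le w : \sum_a' d col' w a' ^ 2 <= \sum_a' d col w a' ^ 2.
  rewrite !split2 rest !addnA leq_add2r; have [h1 [h2 h3]] := bal w.
  by have [] := balanced_squares h1 h2 h3.
have lt : \sum_a' d col' v a' ^ 2 < \sum_a' d col v a' ^ 2.
  rewrite !split2 rest !addnA ltn_add2r; have [h1 [h2 h3]] := bal v.
  by have [_ ] := balanced_squares h1 h2 h3; apply.
have := minP col'; rewrite leqNgt => /negP; apply.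
rewrite /Phi (bigD1 v) //= [ltnRHS](bigD1 v) //= -addSn leq_add //.
by apply: leq_sum => w _; exact: le.
Qed.

(** One colour of an equitable colouring with m colours: at a vertex of degree [q * m] the colour
    counts average to the integer q and differ by at most one, so each equals q. Nothing is claimed
    at the other vertices. *)
Lemma regular_factor (E L R : finType) (l : E -> L) (r : E -> R) (m : nat) :
  0 < m ->
  exists F : E -> bool,
    (forall x q, \sum_e (l e == x) = q * m -> \sum_e (l e == x) * F e = q) /\
    (forall y q, \sum_e (r e == y) = q * m -> \sum_e (r e == y) * F e = q).
Proof.
move=> m0; have [col hcol] := equitable_colouring l r m0.
pose a := Ordinal m0.
have key v q : \sum_e incident l r v e = q * m ->
  \sum_e incident l r v e * (col e == a) = q.
  pose d b := #|[set e | incident l r v e & col e == b]|.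
  move=> deg.
  have -> : \sum_e incident l r v e * (col e == a) = d a.
    rewrite /d -sum1_card [RHS](eq_bigl (fun e => incident l r v e && (col e == a))).
      by rewrite [RHS]big_mkcond; apply: eq_bigr => e _; case: incident; case: (_ == _).
    by move=> e; rewrite inE.
  have sumd : \sum_b d b = q * m.
    rewrite -deg (partition_big col xpredT) //=; apply: eq_bigr => b _.
    rewrite /d -sum1_card [LHS]big_mkcond [RHS]big_mkcond.
    by apply: eq_bigr => e _; rewrite inE; case: incident; case: (_ == _).
  have le1 : \sum_b d b <= \sum_(b < m) (d a).+1 - 1.
    rewrite (bigD1 a) //= [X in _ <= X - 1](bigD1 a) //= addSn subn1 /= leq_add2l.
    by apply: leq_sum => b _; exact: hcol.
  (* The summand 1 stands for colour a itself, which exceeds [(d a).-1]; this fails when [d a = 0],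
     as the predecessor is truncated. *)
  have le2 : \sum_(b < m) (d a).-1 + 1 <= \sum_b d b \/ d a = 0.
    case: (posnP (d a)) => [|da0]; [by right | left].
    rewrite (bigD1 a) //= [leqRHS](bigD1 a) //= addnAC addn1 prednK // leq_add2l.
    apply: leq_sum => b _; have := hcol v a b; rewrite -/(d a) -/(d b); lia.
  rewrite sumd !sum_nat_const !card_ord in le1 le2.
  apply/eqP; rewrite eqn_leq; apply/andP; split.
    case: le2 => [le2|->] //.
    suff : (d a).-1 < q by lia.
    by rewrite -(ltn_pmul2r m0) [_ * m]mulnC; lia.
  have : 0 < m * (d a).+1 by rewrite muln_gt0 m0.
  by move=> h; rewrite -ltnS -(ltn_pmul2r m0) [X in _ < X]mulnC; lia.
exists (fun e => col e == a); split=> x q h.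
  exact: (key (inl x)).
exact: (key (inr x)).
Qed.

(** * Adding the new vertices one at a time *)

Lemma perm_two (T : eqType) (x0 : T) (s : seq T) i j :
  i < size s -> j < size s -> i != j ->
  exists Q, perm_eq s (nth x0 s i :: nth x0 s j :: Q).
Proof.
move=> li lj ij; pose I := iota 0 (size s).
have iI : i \in I by rewrite mem_iota.
have jI : j \in rem i I by rewrite mem_rem_uniq ?iota_uniq // !inE eq_sym ij mem_iota.
exists [seq nth x0 s n | n <- rem j (rem i I)].
rewrite -{1}(mkseq_nth x0 s) /mkseq -!map_cons; apply: perm_map.
rewrite (perm_trans (perm_to_rem iI)) // perm_cons; exact: perm_to_rem.
Qed.

Section Joining.
Variable N : nat.
Implicit Types (p q : seq 'I_N) (P Q : seq (seq 'I_N)) (u v x y : 'I_N).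

Definition orient (b : bool) p := if b then rev p else p.

Lemma perm_orient b p : perm_eq (orient b p) p.
Proof. by case: b; rewrite //= perm_rev. Qed.

Lemma pmult_orient b p u v : pmult (orient b p) u v = pmult p u v.
Proof. by case: b; rewrite //= pmult_rev. Qed.

Lemma endsE P v : ends P v =
  \sum_(p <- P) \sum_(b : bool) (ohead (orient b p) == Some v).
Proof. by apply: eq_bigr => p _; rewrite big_bool addnC. Qed.

(** The flags b and c say which end of each path is joined to x. Empty paths are allowed: x then
    becomes an end of its path, and the number of paths still drops by one. *)
Lemma join_at_vertex P x i j b c :
  x \notin flatten P -> i < size P -> j < size P -> i != j ->
  exists P', [/\ size P' = (size P).-1,
    perm_eq (flatten P') (x :: flatten P),
    forall u v, u != x -> v != x -> mult P' u v = mult P u v &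
    forall v, v != x -> mult P' x v =
      (ohead (orient b (nth [::] P i)) == Some v)
      + (ohead (orient c (nth [::] P j)) == Some v)].
Proof.
move=> xP li lj ij; have [Q pQ] := perm_two [::] li lj ij.
set A := nth _ _ i in pQ *; set B := nth _ _ j in pQ *.
have pf := perm_flatten pQ.
have := xP; rewrite (perm_mem pf) /= !mem_cat !negb_or => /and3P[xA xB xQ].
have xA' : x \notin rev (orient b A) by rewrite mem_rev (perm_mem (perm_orient b A)).
have xB' : x \notin orient c B by rewrite (perm_mem (perm_orient c B)).
exists ((rev (orient b A) ++ x :: orient c B) :: Q); split.
- by rewrite (perm_size pQ).
- apply: (@perm_trans _ (x :: flatten (A :: B :: Q))); last by rewrite perm_cons perm_sym.
  apply/permP => a; rewrite /= !count_cat /= count_rev.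
  by rewrite !(permP (perm_orient _ _)) addnCA !addnA.
- move=> u v ux vx; rewrite (mult_perm _ _ pQ) !mult_cons pmult_cat pmult_cons.
  rewrite pmult_rev !pmult_orient [ohead (x :: _)]/=.
  by rewrite link_away // linkC link_away // addn0 add0n addnA.
move=> v vx; rewrite mult_cons pmult_cat pmult_cons.
rewrite pmult_notin // (pmult_notin _ xB') mult_notin // !addn0 add0n revK.
by rewrite link_end // linkC link_end.
Qed.

(** Reads a 0/1 factor as two ends on distinct paths. The arbitrary weight [f] will be the indicator
    that an end is a given vertex. *)
Lemma two_choices m (U : 'I_m -> bool -> bool) :
  (forall j, \sum_b U j b <= 1) -> \sum_j \sum_b U j b = 2 ->
  exists j1 b1 j2 b2, j1 != j2 /\
    forall f : 'I_m -> bool -> nat,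
      \sum_j \sum_b f j b * U j b = f j1 b1 + f j2 b2.
Proof.
move=> U1 U2; pose S := [set z | U z.1 z.2].
have sumS (f : 'I_m -> bool -> nat) :
    \sum_j \sum_b f j b * U j b = \sum_(z in S) f z.1 z.2.
  rewrite pair_bigA [RHS]big_mkcond; apply: eq_bigr => z _.
  by rewrite inE; case: (U _ _); rewrite ?muln1 ?muln0.
have /eqP/cards2P[x [y [xy SE]]] : #|S| = 2.
  rewrite -U2 -sum1_card -(sumS (fun _ _ => 1)).
  by apply: eq_bigr => j _; apply: eq_bigr => b _; rewrite mul1n.
exists x.1, x.2, y.1, y.2; split; last first.
  by move=> f; rewrite sumS SE big_setU1 ?inE //= big_set1.
apply/eqP => e; have := U1 x.1; rewrite big_bool.
have : U x.1 x.2 by have := set21 x y; rewrite -SE inE.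
have : U x.1 y.2 by have := set22 x y; rewrite -SE inE e.
have : x.2 != y.2 by apply: contraNneq xy => e2; apply/eqP/eqP; rewrite -pair_eqE /= e e2 !eqxx.
by case: x.2; case: y.2 => // _ -> ->.
Qed.

End Joining.

Section Embedding.
Variables (N k mu : nat).
Implicit Types (P : 'I_k -> seq (seq 'I_N)) (R : seq 'I_N).

(** [R] lists the vertices still to be added; multiplicities are prescribed only between vertices
    already present. *)
Definition decomposes P R : Prop :=
  [/\ uniq R, forall i, perm_eq (flatten (P i) ++ R) (enum 'I_N) &
    forall u v, u != v -> u \notin R -> v \notin R -> \sum_(i < k) mult (P i) u v = mu].

Lemma decomposes_uniq P R i : decomposes P R -> uniq (flatten (P i)).
Proof.
case=> _ /(_ i) /perm_uniq; rewrite enum_uniq cat_uniq => /idP /and3P[] //.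
Qed.

Lemma decomposes_mem P R i v : decomposes P R ->
  (v \in flatten (P i)) = (v \notin R).
Proof.
case=> _ h _; have := perm_mem (h i) v; have := perm_uniq (h i).
rewrite enum_uniq mem_enum mem_cat cat_uniq => /and3P[_ /hasPn hR _].
by case: (boolP (v \in R)) => [/hR /negPf //|_]; rewrite orbF.
Qed.

Lemma decomposes_deg P R v : decomposes P R -> v \notin R ->
  \sum_(i < k) \sum_(u < N) mult (P i) v u = mu * (N - (size R).+1).
Proof.
move=> dec vR; have [uR perm tot] := dec; rewrite exchange_big /=.
rewrite (eq_bigr (fun u => if u \notin v :: R then mu else 0)) => [|u _]; last first.
  rewrite inE negb_or eq_sym; case: (eqVneq v u) => [<-|vu] /=.
    by rewrite big1 // => i _; apply/mult_diag/decomposes_uniq/dec.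
  case: (boolP (u \in R)) => uinR /=; last exact: tot.
  rewrite big1 // => i _; rewrite multC mult_notin //.
  by rewrite (decomposes_mem _ _ dec) uinR.
rewrite -big_mkcond sum_nat_const mulnC; congr (_ * _).
have uvR : uniq (v :: R) by rewrite /= vR.
have := cardC (mem (v :: R)); rewrite (card_uniqP uvR) card_ord /= => e.
by apply: (@addnI (size R).+1); rewrite subnKC -?{2}e ?leq_addr.
Qed.

(** Of the 2k edge slots of v, all are used up except those needed for its mu edges to each vertex
    of R. *)
Lemma decomposes_ends P R v : k.*2 = mu * (N - 1) -> decomposes P R ->
  v \notin R -> \sum_(i < k) ends (P i) v = mu * size R.
Proof.
move=> hk dec vR; have d := decomposes_deg dec vR.
have : \sum_(i < k) (\sum_(u < N) mult (P i) v u + ends (P i) v) = k.*2.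
  transitivity (\sum_(i < k) 2); last by rewrite sum_nat_const card_ord muln2.
  apply: eq_bigr => i _.
  rewrite mult_deg ?(decomposes_uniq i dec) // count_uniq_mem ?(decomposes_uniq i dec) //.
  by rewrite (decomposes_mem i v dec) vR.
have : size (v :: R) <= N.
  have [uR _ _] := dec; have uvR : uniq (v :: R) by rewrite /= vR.
  by rewrite -(card_uniqP uvR); apply: leq_trans (max_card _) _; rewrite card_ord.
rewrite big_split /= d hk => lN e.
have : mu * (N - 1) = mu * (N - (size R).+1) + mu * size R.
  by rewrite -mulnDr; congr (_ * _); lia.
lia.
Qed.

Lemma embed_step P x R :
  k.*2 = mu * (N - 1) -> decomposes P (x :: R) -> R != [::] ->
  (forall i, size (P i) = (size R).+1) ->
  exists P', [/\ decomposes P' R, forall i, size (P' i) = size R &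
    forall i u v, mult (P i) u v <= mult (P' i) u v].
Proof.
move=> hk dec R0 szP; have [uR perm tot] := dec.
pose m := (size R).+1; pose g := (size R).-1.
have mE : m = 2 + g by rewrite /m /g; case: (R) R0.
pose E : finType := (('I_k * 'I_m) * ((bool + bool) + 'I_g))%type.
(* Empty paths offer their ends at the vertex [None], whose degree is left unconstrained. *)
pose end_at (c : 'I_k * 'I_m) b := ohead (orient b (nth [::] (P c.1) c.2)).
(* Every path of a class offers its two ends to x, at most one of which may be
   used: the elements [inl (inr b)] and [inr t] model, for a path c, the edges from
   an auxiliary vertex c' to the class of c and (m - 2 parallel ones) to c, so that
   c and c' get degree m, a class degree 2m and a vertex v degree mu * m. *)
pose l (e : E) : option 'I_N + ('I_k * 'I_m) :=
  if e.2 is inl (inl b) then inl (end_at e.1 b) else inr e.1.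
pose r (e : E) : ('I_k * 'I_m) + 'I_k :=
  if e.2 is inl (inr _) then inr e.1.1 else inl e.1.
have sum_pair (I J : finType) (X : I * J -> nat) :
    \sum_z X z = \sum_i \sum_j X (i, j).
  by rewrite pair_bigA; apply: eq_bigr => -[].
have sumE (G : E -> nat) : \sum_e G e =
    \sum_c (\sum_b G (c, inl (inl b)) + \sum_b G (c, inl (inr b)) +
            \sum_t G (c, inr t)).
  transitivity (\sum_c \sum_z G (c, z)); first exact: sum_pair.
  by apply: eq_bigr => c _; rewrite !big_sumType.
have delta (I : finType) (i0 : I) (X : I -> nat) : \sum_i (i == i0) * X i = X i0.
  rewrite (bigD1 i0) //= eqxx mul1n big1 ?addn0 // => i /negPf ->.
  by rewrite mul0n.
have r_inl (G : E -> nat) c : \sum_e (r e == inl c) * G e =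
    \sum_b G (c, inl (inl b)) + \sum_t G (c, inr t).
  rewrite sumE -(delta _ c (fun c => \sum_b G (c, inl (inl b)) + \sum_t G (c, inr t))).
  apply: eq_bigr => c' _; rewrite mulnDr !big_distrr /=; congr (_ + _).
  by rewrite [X in _ + X]big1 ?addn0.
have l_inr (G : E -> nat) c : \sum_e (l e == inr c) * G e =
    \sum_b G (c, inl (inr b)) + \sum_t G (c, inr t).
  rewrite sumE -(delta _ c (fun c => \sum_b G (c, inl (inr b)) + \sum_t G (c, inr t))).
  apply: eq_bigr => c' _; rewrite mulnDr !big_distrr /=; congr (_ + _).
  by rewrite [X in X + _]big1 ?add0n.
have r_inr (G : E -> nat) i : \sum_e (r e == inr i) * G e =
    \sum_j \sum_b G ((i, j), inl (inr b)).
  rewrite sumE -(delta _ i (fun i => \sum_j \sum_b G ((i, j), inl (inr b)))).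
  rewrite sum_pair; apply: eq_bigr => i' _; rewrite big_distrr; apply: eq_bigr => j _ /=.
  by rewrite [X in X + _ + _]big1 // [X in _ + X]big1 // addn0 add0n big_distrr.
have l_inl (G : E -> nat) v : \sum_e (l e == inl (Some v)) * G e =
    \sum_(i < k) \sum_j \sum_b (end_at (i, j) b == Some v) * G ((i, j), inl (inl b)).
  rewrite sumE sum_pair; apply: eq_bigr => i' _; apply: eq_bigr => j _.
  by rewrite [X in _ + X + _]big1 // [X in _ + X]big1 // !addn0.
have [F [Fl Fr]] := regular_factor l r (ltn0Sn (size R) : 0 < m).
have one (X : E -> bool) : \sum_e X e = \sum_e X e * 1.
  by apply: eq_bigr => e _; rewrite muln1.
have sum2 : \sum_(b : bool) 1 = 2 by rewrite sum1_card card_bool.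
have sumg : \sum_(t < g) 1 = g by rewrite sum1_card card_ord.
have Fin c : \sum_b F (c, inl (inl b)) + \sum_t F (c, inr t) = 1.
  by rewrite -(r_inl F); apply: Fr; rewrite one r_inl sum2 sumg mul1n mE.
have Fout c : \sum_b F (c, inl (inr b)) + \sum_t F (c, inr t) = 1.
  by rewrite -(l_inr F); apply: Fl; rewrite one l_inr sum2 sumg mul1n mE.
have Fclass i : \sum_j \sum_b F ((i, j), inl (inr b)) = 2.
  rewrite -(r_inr F); apply: Fr; rewrite one r_inr.
  by under eq_bigr do rewrite sum2; rewrite sum_nat_const card_ord mulnC.
have nthP i (j : 'I_m) : j < size (P i) by rewrite szP.
have end_sum i v : \sum_j \sum_b (end_at (i, j) b == Some v) = ends (P i) v.
  by rewrite endsE (big_nth [::]) szP big_mkord.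
have Fvert v : v \notin x :: R ->
    \sum_(i < k) \sum_j \sum_b (end_at (i, j) b == Some v) * F ((i, j), inl (inl b)) = mu.
  move=> vR; rewrite -(l_inl F); apply: Fl; rewrite one l_inl.
  rewrite -[m]/(size (x :: R)) -(decomposes_ends hk dec vR); apply: eq_bigr => i _.
  rewrite -end_sum; apply: eq_bigr => j _; apply: eq_bigr => b _.
  by rewrite muln1.
have class i : exists P'i, [/\ size P'i = size R,
    perm_eq (flatten P'i) (x :: flatten (P i)),
    forall u v, u != x -> v != x -> mult P'i u v = mult (P i) u v &
    forall v, v != x -> mult P'i x v =
      \sum_j \sum_b (end_at (i, j) b == Some v) * F ((i, j), inl (inl b))].
  (* [Fin] and [Fout] share the sum over the parallel edges between c and c', so path c uses as many
     ends as c' sends edges to the class: at most one per path and two per class. *)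
  pose U j b := F ((i, j), inl (inl b)).
  have [j||j1 [b1 [j2 [b2 [jj UE]]]]] := @two_choices m U.
  - by rewrite -(Fin (i, j)) leq_addr.
  - rewrite -(Fclass i); apply: eq_bigr => j _.
    by have := Fin (i, j); rewrite -(Fout (i, j)) => /addIn.
  have xP : x \notin flatten (P i) by rewrite (decomposes_mem i x dec) mem_head.
  have [P'i [s1 s2 s3 s4]] := join_at_vertex b1 b2 xP (nthP i j1) (nthP i j2) jj.
  exists P'i; split=> // [|v vx]; first by rewrite s1 szP.
  by rewrite s4 // (UE (fun j b => end_at (i, j) b == Some v)).
have [P' P'P] := fin_all_exists class.
have nx u : u != x -> u \notin R -> u \notin x :: R by rewrite inE negb_or => ->.
exists P'; split.
- split=> [|i|u v uv ur vr].
  + by move: uR => /andP[].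
  + have [_ s2 _ _] := P'P i.
    apply: perm_trans (perm i); rewrite perm_sym -cat1s perm_catCA /= perm_sym -cat_cons.
    by rewrite perm_cat2r.
  + wlog vx : u v uv ur vr / v != x => [H|].
      case: (eqVneq v x) => [e|]; last exact: H.
      rewrite (eq_bigr (fun i => mult (P' i) v u)) => [|i _]; last exact: multC.
      by apply: H => //; rewrite -?e // eq_sym.
    case: (eqVneq u x) => [->|ux].
      rewrite -(Fvert v); last exact: nx.
      by apply: eq_bigr => i _; have [_ _ _ ->] := P'P i.
    rewrite -(tot u v) ?nx //; apply: eq_bigr => i _.
    by have [_ _ -> //] := P'P i.
- by move=> i; have [] := P'P i.
move=> i u v; have [_ _ s3 _] := P'P i.
have xP : x \notin flatten (P i) by rewrite (decomposes_mem i x dec) mem_head.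
case: (eqVneq u x) => [->|ux]; first by rewrite mult_notin.
case: (eqVneq v x) => [->|vx]; first by rewrite multC mult_notin.
by rewrite s3.
Qed.

Lemma pcount_rot (ps : seq ('I_N * 'I_N)) n u v :
  pcount (rot n ps) u v = pcount ps u v.
Proof. by rewrite /pcount; apply/permP; rewrite perm_rot. Qed.

(** The last summand is the loop of a one-vertex cycle. For a singleton p the two [link] terms are
    the two parallel edges. *)
Lemma cycle_pairs_cons (x : 'I_N) (p : seq 'I_N) u v :
  pcount (cycle_pairs (x :: p)) u v =
  link (Some x) (ohead p) u v + pmult p u v + link (ohead (rev p)) (Some x) u v
    + (if p is [::] then edge_ind x x u v else 0).
Proof.
rewrite /cycle_pairs rot1_cons.
suff H y (q : seq 'I_N) : pcount (zip (y :: q) (rcons q x)) u v =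
    pmult (y :: q) u v + link (ohead (rev (y :: q))) (Some x) u v.
  case: p => [|y q]; first by rewrite H ohead_rev_cons /pmult /path_pairs /=.
  by rewrite [rcons _ _]/= pcount_cons H /= !addnA addn0.
elim: q y => [|z q IH] y; first by rewrite /pmult /path_pairs /= addn0.
rewrite [rcons _ _]/= [zip _ _]/= pcount_cons IH [in RHS]pmult_cons addnA.
by rewrite [in RHS]ohead_rev_cons.
Qed.

Lemma embed_cycles P R : 1 < N ->
  k.*2 = mu * (N - 1) -> decomposes P R -> R != [::] ->
  (forall i, size (P i) = size R) ->
  exists s : 'I_k -> seq 'I_N, [/\ forall i, perm_eq (s i) (enum 'I_N),
    forall u v, u != v -> \sum_(i < k) pcount (cycle_pairs (s i)) u v = mu &
    forall i u v, mult (P i) u v <= pcount (cycle_pairs (s i)) u v].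
Proof.
move=> N1 hk; elim: R P => // x R IH P dec _ szP.
case: (eqVneq R [::]) => [R0|R0]; last first.
  have [P' [dec' szP' le']] := embed_step hk dec R0 szP.
  have [s [s1 s2 s3]] := IH P' dec' R0 szP'.
  exists s; split=> // i u v; exact: leq_trans (le' i u v) (s3 i u v).
subst R; have [_ perm tot] := dec.
pose p i := nth [::] (P i) 0.
have PE i : P i = [:: p i] by move: (szP i); rewrite /p; case: (P i) => // a [].
have permp i : perm_eq (x :: p i) (enum 'I_N).
  by apply: perm_trans (perm i); rewrite PE /= cats0 cats1 perm_sym perm_rcons.
have p0 i : p i != [::].
  apply/eqP => e; have := perm_size (permp i); rewrite e size_enum_ord /= => N1'.
  by rewrite -N1' in N1.
have cyc i u v : pcount (cycle_pairs (x :: p i)) u v =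
    link (Some x) (ohead (p i)) u v + pmult (p i) u v + link (ohead (rev (p i))) (Some x) u v.
  by rewrite cycle_pairs_cons; case: (p i) (p0 i) => // *; rewrite addn0.
have pm i u v : mult (P i) u v = pmult (p i) u v by rewrite PE /mult big_seq1.
exists (fun i => x :: p i); split=> //; last first.
  by move=> i u v; rewrite cyc pm -addnAC leq_addl.
move=> u v uv; wlog vx : u v uv / v != x => [H|].
  case: (eqVneq v x) => [e|]; last exact: H.
  rewrite (eq_bigr (fun i => pcount (cycle_pairs (x :: p i)) v u)) => [|i _]; last exact: pcountC.
  by apply: H => //; rewrite -?e // eq_sym.
case: (eqVneq u x) => [->|ux]; last first.
  rewrite -(tot u v uv) ?inE //; apply: eq_bigr => i _.
  by rewrite cyc linkC !link_away // pm addn0.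
(* Closing the single path of each class joins x to all its free ends, and v has mu of them in
   total. *)
have := decomposes_ends hk dec (_ : v \notin [:: x]); rewrite inE vx muln1 => <- //.
apply: eq_bigr => i _; rewrite cyc linkC !link_end // PE /ends big_seq1.
rewrite pmult_notin ?addn0 //.
have := perm_uniq (permp i); rewrite enum_uniq => /andP[] //.
Qed.

End Embedding.

(** * Adding edges to families of paths *)

Section PathSystems.
Variable N : nat.
Implicit Types (p q : seq 'I_N) (P Q : seq (seq 'I_N)) (u v w x y : 'I_N).

Definition path_system P := perm_eq (flatten P) (enum 'I_N).

Lemma path_system_uniq P : path_system P -> uniq (flatten P).
Proof. by move=> h; rewrite (perm_uniq h) enum_uniq. Qed.

Lemma path_system_deg P v : path_system P ->
  \sum_(x < N) mult P v x + ends P v = 2.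
Proof.
move=> h; rewrite mult_deg ?path_system_uniq // count_uniq_mem ?path_system_uniq //.
by rewrite (perm_mem h) mem_enum.
Qed.

Definition joins p u v :=
  (ohead p == Some u) && (ohead (rev p) == Some v)
  || (ohead p == Some v) && (ohead (rev p) == Some u).

(* The edge uv can be added to P unless [blocked P u v]: it would have to join the ends
   of two distinct paths. *)
Definition blocked P u v :=
  (ends P u + ends P v <= 2) &&
  ((ends P u == 1) && (ends P v == 1) ==> has (fun p => joins p u v) P).

Lemma ohead_mem p u : ohead p = Some u -> u \in p.
Proof. by case: p => // x p [->]; rewrite mem_head. Qed.

Lemma mem_flatten_uniq (S : seq (seq 'I_N)) p q u :
  uniq (flatten S) -> p \in S -> q \in S -> u \in p -> u \in q -> p = q.
Proof.
move=> uS pS qS up uq; have h := perm_to_rem pS.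
move: uS; rewrite (perm_uniq (perm_flatten h)) /= cat_uniq => /and3P[_ /hasPn no _].
move: qS; rewrite (perm_mem h) inE => /orP[/eqP -> //|qS].
have /no : u \in flatten (rem p S) by apply/flattenP; exists q.
by rewrite /= up.
Qed.

Lemma ends_path P p u : uniq (flatten P) -> p \in P -> u \in p ->
  ends P u = (ohead p == Some u) + (ohead (rev p) == Some u).
Proof.
move=> uP pP up; have h := perm_to_rem pP.
rewrite /ends (perm_big _ h) /= big_cons [X in _ + X]big1_seq ?addn0 // => q /andP[_ qP].
have uq : u \notin q.
  apply: contraTN up => uq; move: uP.
  rewrite (perm_uniq (perm_flatten h)) /= cat_uniq => /and3P[_ /hasPn no _].
  by apply: no; apply/flattenP; exists q.
suff H o : (forall x, o = Some x -> x \in q) -> (o == Some u) = false.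
  rewrite !H // => x /ohead_mem //; by rewrite mem_rev.
by move=> hq; apply/negbTE; apply: contra uq => /eqP /hq.
Qed.

Lemma ends_gt0 P u : 0 < ends P u ->
  exists i b, i < size P /\ ohead (orient b (nth [::] P i)) = Some u.
Proof.
rewrite endsE (big_nth [::]) big_mkord lt0n => h.
have [i hi] : exists i : 'I_(size P),
    \sum_(b : bool) (ohead (orient b (nth [::] P i)) == Some u) != 0.
  apply/existsP; rewrite -negb_forall; apply: contra h => /forallP h.
  by rewrite big1 // => i _; apply/eqP.
move: hi; rewrite big_bool /=.
case: (eqVneq (ohead (rev (nth [::] P i))) (Some u)) => [e _|_].
  by exists i, true.
by case: (eqVneq (ohead (nth [::] P i)) (Some u)) => [e _|_] //; exists i, false.
Qed.

(** If u and v both have free ends, linking them fails only when they are the two ends of one path;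
    as u and v differ, each then has exactly one free end, which is the second way of being
    blocked. *)
Lemma add_edge P u v : path_system P -> u != v -> ~~ blocked P u v ->
  exists P', path_system P' /\
    forall a b, mult P' a b = mult P a b + edge_ind u v a b.
Proof.
move=> sP uv nb; have uP := path_system_uniq sP.
have [du dv] := (path_system_deg u sP, path_system_deg v sP).
have [eu|] := posnP (ends P u).
  by case/negP: nb; rewrite /blocked eu andFb andbT; lia.
have [ev _|] := posnP (ends P v).
  by case/negP: nb; rewrite /blocked ev andbF andbT; lia.
move=> /ends_gt0[j [c [lj hj]]] /ends_gt0[i [b [li hi]]].
have [ij|ij] := eqVneq i j; last first.
  have [Q pQ] := perm_two [::] li lj ij.
  set A := nth _ _ i in pQ hi *; set B := nth _ _ j in pQ hj *.
  exists ((rev (orient b A) ++ orient c B) :: Q); split.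
    apply: perm_trans sP; rewrite perm_sym (perm_trans (perm_flatten pQ)) //= catA.
    rewrite perm_cat2r perm_cat // perm_sym ?perm_orient //.
    by rewrite perm_rev perm_orient.
  move=> x y; rewrite (mult_perm _ _ pQ) !mult_cons pmult_cat.
  rewrite pmult_rev !pmult_orient revK hi hj /=.
  by rewrite -!addnA; congr (_ + _); rewrite addnC -addnA.
subst j; set p := nth _ _ i in hi hj; have pP : p \in P by rewrite mem_nth.
have mem_or a x : ohead (orient a p) = Some x -> x \in p.
  by move=> /ohead_mem; rewrite (perm_mem (perm_orient a p)).
have jp : joins p u v.
  move: hi hj; rewrite /joins /orient; case: b; case: c => -> //.
  - by case=> e; rewrite e eqxx in uv.
  - by move=> ->; rewrite !eqxx orbT.
  - by move=> ->; rewrite !eqxx.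
  - by case=> e; rewrite e eqxx in uv.
case/negP: nb; apply/andP; split; last by apply/implyP => _; apply/hasP; exists p.
have neq x y : x != y -> (Some x == Some y :> option 'I_N) = false.
  by move=> xy; apply: negbTE; apply: contra xy => /eqP[->].
rewrite !(@ends_path P p) //; [|exact: mem_or hj|exact: mem_or hi].
move: jp; rewrite /joins => /orP[] /andP[/eqP -> /eqP ->].
  by rewrite !eqxx !neq // eq_sym.
by rewrite !eqxx !neq // eq_sym.
Qed.

Lemma sum_ltn_sym (f : 'I_N -> 'I_N -> nat) :
  (forall a b, f a b = f b a) -> (forall a, f a a = 0) ->
  \sum_(a < N) \sum_(b < N) f a b = (\sum_(a < N) \sum_(b < N | a < b) f a b).*2.
Proof.
move=> fC f0.
rewrite -addnn [X in _ = _ + X](exchange_big_dep xpredT) //= -big_split /=.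
apply: eq_bigr => a _; rewrite (bigID (fun b : 'I_N => a < b)) /=; congr (_ + _).
rewrite (bigD1 a) ?ltnn //= f0 add0n.
rewrite (eq_bigl (fun b : 'I_N => b < a)) => [|b]; first exact: eq_bigr.
by rewrite -leqNgt ltn_neqAle andbC.
Qed.

(** Only the edges between u and v are counted in both degrees. *)
Lemma row_pair_le (f : 'I_N -> 'I_N -> nat) u v :
  (forall a b, f a b = f b a) -> (forall a, f a a = 0) -> u != v ->
  \sum_(x < N) f u x + \sum_(x < N) f v x
    <= \sum_(a < N) \sum_(b < N | a < b) f a b + f u v.
Proof.
move=> fC f0 uv; rewrite -leq_double [leqRHS]doubleD -(sum_ltn_sym fC f0).
have split2 (g : 'I_N -> nat) :
    \sum_(a < N) g a = g u + (g v + \sum_(a < N | (a != u) && (a != v)) g a).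
  by rewrite (bigD1 u) //= (bigD1 v) 1?eq_sym.
have rest : \sum_(a < N | (a != u) && (a != v)) f u a +
    \sum_(a < N | (a != u) && (a != v)) f v a
    <= \sum_(a < N | (a != u) && (a != v)) \sum_(b < N) f a b.
  rewrite -big_split; apply: leq_sum => a _ /=.
  by rewrite (split2 (f a)) [f u a]fC [f v a]fC addnA leq_addr.
rewrite (split2 (fun a => \sum_(b < N) f a b)).
move: rest; rewrite (split2 (f u)) (split2 (f v)) !f0 [f v u]fC.
lia.
Qed.

Lemma mult_row_pair P u v : path_system P -> u != v ->
  \sum_(x < N) mult P u x + \sum_(x < N) mult P v x <= size_edges P + mult P u v.
Proof.
move=> sP uv; rewrite -mult_sum ?path_system_uniq //.
apply: row_pair_le uv => [a b|a]; first exact: multC.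
exact/mult_diag/path_system_uniq.
Qed.

Lemma mult_le_row P u v : mult P u v <= \sum_(x < N) mult P u x.
Proof. by rewrite (bigD1 v) //= leq_addr. Qed.

Lemma mult_le_size_edges P u v : path_system P -> u != v ->
  mult P u v <= size_edges P.
Proof.
move=> sP uv; have := mult_row_pair sP uv; have := mult_le_row P u v.
have := mult_le_row P v u; rewrite [mult P v u]multC; lia.
Qed.

(** The degrees of u and v add up to at most 1, which leaves at least three free ends. *)
Lemma unblocked_sparse P u v : path_system P -> u != v ->
  size_edges P <= 1 -> mult P u v = 0 -> ~~ blocked P u v.
Proof.
move=> sP uv s1 m0; apply/negP => /andP[h _].
have := mult_row_pair sP uv.
have := path_system_deg u sP; have := path_system_deg v sP; lia.
Qed.

End PathSystems.

(** * Distributing the missing edges greedily *)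

Section Filling.
Variables (N k : nat).
Implicit Types (P Q : 'I_k -> seq (seq 'I_N)) (u v w : 'I_N).

Definition path_systems P := forall i, path_system (P i).

Definition total P u v := \sum_(i < k) mult (P i) u v.

(** The other classes stay equal as lists of paths, because [blocked] refers to the paths
    themselves. *)
Definition places P P' (j : 'I_k) u v :=
  [/\ path_systems P', forall i, i != j -> P' i = P i &
    forall i a b, mult (P' i) a b = mult (P i) a b + (i == j) * edge_ind u v a b].

Lemma place P j u v : path_systems P -> u != v -> ~~ blocked (P j) u v ->
  exists P', places P P' j u v.
Proof.
move=> sP uv nb; have [R [sR hR]] := add_edge (sP j) uv nb.
exists (fun i => if i == j then R else P i); split=> i.
- by case: ifP.
- by move=> /negPf ->.
by move=> a b; case: eqP => [->|_]; rewrite ?mul1n ?addn0.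
Qed.

Lemma places_le P P' j u v : places P P' j u v ->
  forall i a b, mult (P i) a b <= mult (P' i) a b.
Proof. by case=> _ _ h i a b; rewrite h leq_addr. Qed.

Lemma places_total P P' j u v a b : places P P' j u v ->
  total P' a b = total P a b + edge_ind u v a b.
Proof.
case=> _ _ h; rewrite /total; under eq_bigr do rewrite h.
rewrite big_split /=; congr (_ + _).
by rewrite (bigD1 j) //= eqxx mul1n big1 ?addn0 // => i /negPf ->.
Qed.

Lemma places_size P P' j u v i : path_systems P -> u != v -> places P P' j u v ->
  size_edges (P' i) = size_edges (P i) + (i == j).
Proof.
move=> sP uv [sP' _ h]; rewrite -!mult_sum ?path_system_uniq //.
under eq_bigr do under eq_bigr do rewrite h.
under eq_bigr do rewrite big_split /= -big_distrr /=.
by rewrite big_split /= -big_distrr /= edge_ind_sum // muln1.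
Qed.

Lemma places_ends P P' j u v i w : path_systems P -> u != v -> places P P' j u v ->
  ends (P' i) w + (i == j) * ((u == w) + (v == w)) = ends (P i) w.
Proof.
move=> sP uv [sP' _ h]; have := path_system_deg w (sP i).
have := path_system_deg w (sP' i).
under eq_bigr do rewrite h.
rewrite big_split /= -big_distrr /= edge_ind_deg //; lia.
Qed.

Lemma total_ends P u : path_systems P ->
  \sum_(v < N) total P u v + \sum_(i < k) ends (P i) u = k.*2.
Proof.
move=> sP; rewrite /total exchange_big -big_split /=.
rewrite (eq_bigr (fun _ => 2)) => [|i _]; last exact: path_system_deg.
by rewrite sum_nat_const card_ord muln2.
Qed.

Lemma unblocked_or P u v :
  (exists i, ~~ blocked (P i) u v) \/
  (forall i, blocked (P i) u v).
Proof.
case: (boolP [forall i, blocked (P i) u v]) => [/forallP|/forallPn]; by [right|left].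
Qed.

Lemma all_blocked_ends P u v : (forall i, blocked (P i) u v) ->
  \sum_(i < k) ends (P i) u + \sum_(i < k) ends (P i) v <= k.*2.
Proof.
move=> h; rewrite -big_split /= -muln2 -[leqRHS](_ : \sum_(i < k) 2 = _).
  by apply: leq_sum => i _; have /andP[] := h i.
by rewrite sum_nat_const card_ord.
Qed.

(** Blocking in every class would leave at most 2k of the 4k edge slots of u and v free. *)
Lemma exists_unblocked P u v : path_systems P ->
  \sum_(x < N) total P u x + \sum_(x < N) total P v x < k.*2 ->
  exists i, ~~ blocked (P i) u v.
Proof.
move=> sP lt; case: (unblocked_or P u v) => // /all_blocked_ends.
have := total_ends u sP; have := total_ends v sP; lia.
Qed.

Lemma total_row P mu (L : seq ('I_N * 'I_N)) u : path_systems P ->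
  all (fun e => e.1 != e.2) L ->
  (forall u v, u != v -> total P u v + pcount L u v = mu) ->
  \sum_(x < N) total P u x + \sum_(x < N) pcount L u x = mu * (N - 1).
Proof.
move=> sP nL tot; rewrite -big_split /= (bigD1 u) //=.
have -> : total P u u = 0.
  by rewrite /total big1 // => i _; apply/mult_diag/path_system_uniq.
have -> : pcount L u u = 0.
  apply/eqP; rewrite -leqn0 leqNgt -has_count; apply/hasPn => e eL /=.
  rewrite orbb; apply/negP => /andP[/eqP e1 /eqP e2].
  by have := allP nL e eL; rewrite e1 e2 eqxx.
rewrite !add0n (eq_bigr (fun _ => mu)) => [|x xu]; last by rewrite tot // eq_sym.
rewrite sum_nat_const mulnC; congr (_ * _).
by have := cardC1 u; rewrite card_ord subn1 => <-; apply: eq_card.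
Qed.

Lemma pcount_head (L : seq ('I_N * 'I_N)) u v : 0 < pcount ((u, v) :: L) u v.
Proof. by rewrite pcount_cons /edge_ind !eqxx. Qed.

Lemma leq_row (L : seq ('I_N * 'I_N)) u v : pcount L u v <= \sum_(x < N) pcount L u x.
Proof. by rewrite (bigD1 v) //= leq_addr. Qed.

Definition completes P Q mu t :=
  [/\ path_systems Q, forall i u v, mult (P i) u v <= mult (Q i) u v,
      forall u v, u != v -> total Q u v = mu &
      forall i, t <= size_edges (Q i)].

Lemma completes_places P P' Q mu t j u v :
  places P P' j u v -> completes P' Q mu t -> completes P Q mu t.
Proof.
move=> pl [h1 h2 h3 h4]; split=> // i a b.
exact: leq_trans (places_le pl i a b) (h2 i a b).
Qed.

Definition deficiency P t := \sum_(i < k) (t - size_edges (P i)).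

Lemma places_deficiency P P' t j u v : path_systems P -> u != v ->
  places P P' j u v ->
  deficiency P t = deficiency P' t + (size_edges (P j) < t).
Proof.
move=> sP uv pl; rewrite /deficiency (bigD1 j) //= [X in _ = X + _](bigD1 j) //=.
rewrite (places_size j sP uv pl) eqxx addnAC; congr (_ + _); first lia.
by apply: eq_bigr => i ij; rewrite (places_size i sP uv pl) (negPf ij) addn0.
Qed.

Lemma deficiency0 P t : deficiency P t = 0 -> forall i, t <= size_edges (P i).
Proof.
by move=> /eqP; rewrite sum_nat_eq0 => /forallP h i; have := h i; rewrite subn_eq0.
Qed.

(** [L] lists the missing edges. As long as some class is short, it is empty because t <= 1 and
    accepts any edge, so the deficiency falls together with [L]; afterwards the degree count finds a
    place. *)
Lemma fill_greedy mu t (L : seq ('I_N * 'I_N)) P :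
  t <= 1 -> mu * (N - 1) <= k -> path_systems P ->
  all (fun e => e.1 != e.2) L ->
  (forall u v, u != v -> total P u v + pcount L u v = mu) ->
  deficiency P t <= size L ->
  exists Q, completes P Q mu t.
Proof.
move=> t1 hk; elim: L P => [|[u v] L IH] P sP nL tot def.
  exists P; split=> // [u v uv|]; first by rewrite -(tot u v uv) addn0.
  by apply: deficiency0; apply/eqP; rewrite -leqn0.
have /andP[/= uv nL'] := nL.
suff [j [nb dj]] : exists j, ~~ blocked (P j) u v /\
    (size_edges (P j) < t \/ deficiency P t = 0).
  have [P' pl] := place sP uv nb.
  have [Q cQ] : exists Q, completes P' Q mu t.
    apply: IH => // [|a b ab|]; first by case: pl.
      by rewrite (places_total _ _ pl) -(tot a b ab) pcount_cons addnA.
    have := places_deficiency t sP uv pl; move: def dj => /=; lia.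
  by exists Q; apply: completes_places pl cQ.
have [d0|] := posnP (deficiency P t).
  have [j nb] : exists j, ~~ blocked (P j) u v; last by exists j; split=> //; right.
  apply: exists_unblocked => //.
  have := total_row u sP nL tot; have := total_row v sP nL tot.
  have := leq_row ((u, v) :: L) u v; have := leq_row ((u, v) :: L) v u.
  have := pcount_head L u v; rewrite [pcount _ v u]pcountC; lia.
rewrite lt0n sum_nat_eq0 => /forallPn[j]; rewrite subn_eq0 -ltnNge => lt.
exists j; split; last by left.
have := mult_le_size_edges (sP j) uv => le.
by apply: unblocked_sparse => //; lia.
Qed.

End Filling.

Lemma eq_leq_sum (I : finType) (f g : I -> nat) :
  (forall i, f i <= g i) -> \sum_i g i <= \sum_i f i -> forall i, f i = g i.
Proof.
move=> fg S i; apply/eqP; rewrite eqn_leq fg leqNgt; apply/negP => lt.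
move: S; rewrite leqNgt => /negP; apply.
rewrite (bigD1 i) //= [X in _ < X](bigD1 i) //= -addSn leq_add //.
by apply: leq_sum => j _.
Qed.

(** * The case mu = 2 and m = n - 2 *)

Section LastTwo.
Variables (N k : nat).
Hypothesis hk : k + 3 = N.*2.
Implicit Types (P Q : 'I_k -> seq (seq 'I_N)) (u v w : 'I_N).

Definition last_pair P w v1 v2 :=
  [/\ path_systems P, w != v1, w != v2, v1 != v2 &
    forall a b, a != b -> total P a b + (edge_ind w v1 a b + edge_ind w v2 a b) = 2].

Lemma sum_indicator (j : 'I_k) : \sum_(i < k) (i == j) = 1.
Proof. by rewrite (bigD1 j) //= eqxx big1 // => i /negPf ->. Qed.

Lemma last_pairC P w v1 v2 : last_pair P w v1 v2 -> last_pair P w v2 v1.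
Proof.
case=> sP n1 n2 n3 tot; split=> // [|a b ab]; first by rewrite eq_sym.
by rewrite addnC [X in X + _]addnC addnC tot.
Qed.

(** With k = 2N - 3, w and v1 have 2k + 1 free ends, so one edge always fits; after that only 2k
    remain at w and v2, which is just enough for the second edge to be blocked everywhere. *)
Lemma last_pair_ends P w v1 v2 : last_pair P w v1 v2 ->
  [/\ \sum_(i < k) ends (P i) w = k.+1, \sum_(i < k) ends (P i) v1 = k &
      \sum_(i < k) ends (P i) v2 = k].
Proof.
case=> sP n1 n2 n3 tot; pose L := [:: (w, v1); (w, v2)].
have nL : all (fun e : 'I_N * 'I_N => e.1 != e.2) L by rewrite /= n1 n2.
have tot' u v : u != v -> total P u v + pcount L u v = 2.
  by move=> uv; rewrite -(tot u v uv) !pcount_cons addn0.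
have row u : \sum_(x < N) pcount L u x = ((w == u) + (v1 == u)) + ((w == u) + (v2 == u)).
  rewrite -(edge_ind_deg u n1) -(edge_ind_deg u n2) -big_split.
  by apply: eq_bigr => x _; rewrite !pcount_cons addn0.
have key u := (total_row u sP nL tot', total_ends u sP).
have := key w; have := key v1; have := key v2; rewrite !row !eqxx.
rewrite ![v1 == w]eq_sym ![v2 == w]eq_sym [v2 == v1]eq_sym.
rewrite (negPf n1) (negPf n2) (negPf n3).
by move=> [? ?] [? ?] [? ?]; split; lia.
Qed.

Lemma finish_two P P1 P2 j j' w v1 v2 : last_pair P w v1 v2 ->
  places P P1 j w v1 -> places P1 P2 j' w v2 ->
  (forall i, 2 <= size_edges (P2 i)) -> exists Q, completes P Q 2 2.
Proof.
move=> [sP n1 n2 n3 tot] pl1 pl2 sz; exists P2.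
apply: (completes_places pl1 (completes_places pl2 _)).
split=> //; first by case: pl2.
move=> u v uv; rewrite (places_total _ _ pl2) (places_total _ _ pl1) -addnA.
exact: tot.
Qed.

(** If w v2 were blocked everywhere afterwards, equality in the count would give w and v2 exactly
    two free ends in each class. In class j this means three before w v1 took one of them, against
    the hypothesis. *)
Lemma last_two_then P j w v1 v2 : last_pair P w v1 v2 ->
  ~~ blocked (P j) w v1 -> ends (P j) w + ends (P j) v2 <= 2 ->
  (forall i, 2 <= size_edges (P i) + (i == j)) ->
  exists Q, completes P Q 2 2.
Proof.
move=> lp nb le2 sz; have [sP n1 n2 n3 tot] := lp.
have [P1 pl1] := place sP n1 nb; have [sP1 _ _] := pl1.
have [Ew _ E2] := last_pair_ends lp.
have ew i : ends (P1 i) w + (i == j) = ends (P i) w.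
  by rewrite -(places_ends i w sP n1 pl1) eqxx [v1 == w]eq_sym (negPf n1) muln1.
have e2 i : ends (P1 i) v2 = ends (P i) v2.
  by rewrite -(places_ends i v2 sP n1 pl1) (negPf n2) (negPf n3) muln0 addn0.
case: (unblocked_or P1 w v2) => [[j' nb']|bl].
  have [P2 pl2] := place sP1 n2 nb'.
  apply: (finish_two lp pl1 pl2) => i.
  rewrite (places_size i sP1 n2 pl2) (places_size i sP n1 pl1).
  exact: leq_trans (sz i) (leq_addr _ _).
have S1 : \sum_(i < k) (ends (P1 i) w + ends (P1 i) v2) = k.*2.
  have : \sum_(i < k) (ends (P1 i) w + (i == j)) = k.+1.
    by rewrite -Ew; apply: eq_bigr => i _; exact: ew.
  rewrite big_split /= sum_indicator => h.
  rewrite (eq_bigr (fun i => ends (P1 i) w + ends (P i) v2)) => [|i _]; last by rewrite e2.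
  by rewrite big_split /= E2; lia.
have blj i : ends (P1 i) w + ends (P1 i) v2 <= 2 by have /andP[] := bl i.
have Sk : \sum_(i < k) 2 = k.*2 by rewrite sum_nat_const card_ord muln2.
have := eq_leq_sum blj _ j; rewrite S1 Sk leqnn => /(_ isT).
by have := ew j; rewrite e2 eqxx; lia.
Qed.

(* If both orders of placing the two edges get stuck, then outside class j the numbers
   of free ends of w, v1, v2 are (2,0,0) or (0,2,2), as (1,1,1) would make the three
   vertices pairwise joined by one path. By parity w is isolated in class j too, so no
   class contains the copy of the edge w v1 that is already placed. *)
Lemma last_two_unblocked P j w v1 v2 : last_pair P w v1 v2 ->
  ~~ blocked (P j) w v1 -> ~~ blocked (P j) w v2 ->
  (forall i, 2 <= size_edges (P i) + (i == j)) ->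
  exists Q, completes P Q 2 2.
Proof.
move=> lp nb1 nb2 sz; have [sP n1 n2 n3 tot] := lp.
have [Ew E1 E2] := last_pair_ends lp.
have ordered v v' (lpv : last_pair P w v v') (nb : ~~ blocked (P j) w v) :
    (exists Q, completes P Q 2 2) \/
    (forall i, ends (P i) w + ends (P i) v' <= 2 + (i == j)) /\
    (forall i, i != j -> ends (P i) w = 1 -> ends (P i) v' = 1 ->
      has (fun p => joins p w v') (P i)).
  have [_ nv nv' nvv' _] := lpv.
  have [P1 pl1] := place sP nv nb; have [sP1 eqP1 _] := pl1.
  case: (unblocked_or P1 w v') => [[j' nb']|bl].
    left; have [P2 pl2] := place sP1 nv' nb'.
    apply: (finish_two lpv pl1 pl2) => i.
    rewrite (places_size i sP1 nv' pl2) (places_size i sP nv pl1).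
    exact: leq_trans (sz i) (leq_addr _ _).
  right; split=> [i|i ij aw av].
    rewrite -(places_ends i w sP nv pl1) -(places_ends i v' sP nv pl1).
    rewrite eqxx [v == w]eq_sym (negPf nv) (negPf nv') (negPf nvv') muln0 muln1 addn0.
    by have /andP[h _] := bl i; rewrite addnAC leq_add2r.
  have /andP[_] := bl i; rewrite (eqP1 i ij) aw av; exact.
case: (ordered v1 v2 lp nb1) => // -[le2 jn2].
case: (ordered v2 v1 (last_pairC lp) nb2) => // -[le1 jn1].
exfalso.
have Sj : \sum_(i < k) (2 + (i == j)) = k.*2.+1.
  by rewrite big_split /= sum_nat_const card_ord muln2 sum_indicator addn1.
have eq2 := eq_leq_sum le2 (_ : _ <= _).
have eq1 := eq_leq_sum le1 (_ : _ <= _).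
have {}eq2 i : ends (P i) w + ends (P i) v2 = 2 + (i == j).
  by apply: eq2; rewrite Sj big_split /= Ew E2; lia.
have {}eq1 i : ends (P i) w + ends (P i) v1 = 2 + (i == j).
  by apply: eq1; rewrite Sj big_split /= Ew E1; lia.
have even i : i != j -> ~~ odd (ends (P i) w).
  move=> ij; have := eq1 i; have := eq2 i; rewrite (negPf ij) addn0 => h2 h1.
  case: (eqVneq (ends (P i) w) 1) => [aw|]; last by case: (ends (P i) w) h1 => [|[|[|?]]].
  have /hasP[p pP jp] : has (fun p => joins p w v2) (P i) by apply: jn2 => //; lia.
  have /hasP[q qP jq] : has (fun p => joins p w v1) (P i) by apply: jn1 => //; lia.
  have wmem r v : joins r w v -> w \in r.
    case/orP=> /andP[/eqP h /eqP h']; first exact: ohead_mem.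
    by rewrite -mem_rev; exact: ohead_mem.
  have pq := mem_flatten_uniq (path_system_uniq (sP i)) pP qP (wmem _ _ jp) (wmem _ _ jq).
  move: jp jq; rewrite pq /joins => /orP[] /andP[/eqP -> /eqP ->];
    by rewrite !(inj_eq Some_inj) eqxx ?[v2 == _]eq_sym ?[v1 == w]eq_sym
               ?(negPf n1) ?(negPf n2) ?(negPf n3) ?andbF.
(* [k] is odd by [hk], so the total [k.+1] of free ends of w is even. *)
have evj : ~~ odd (ends (P j) w).
  have : ~~ odd (\sum_(i < k) ends (P i) w) by rewrite Ew; lia.
  rewrite (bigD1 j) //= oddD.
  have /negPf -> : ~~ odd (\sum_(i < k | i != j) ends (P i) w).
    by apply: (big_ind (fun n => ~~ odd n)) => // n n' h h'; rewrite oddD (negPf h).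
  by rewrite addbF.
have zero i : mult (P i) w v1 = 0.
  have dw := path_system_deg w (sP i); have dv := path_system_deg v1 (sP i).
  have mw := mult_le_row (P i) w v1; have mv := mult_le_row (P i) v1 w.
  rewrite multC in mv; have := eq1 i.
  have [ij|ij] := eqVneq i j.
    by rewrite -ij in evj; case: (ends (P i) w) evj dw => [|[|[|n]]] //; lia.
  by have := even i ij; case: (ends (P i) w) dw => [|[|[|n]]] //; lia.
have := tot w v1 n1; rewrite /total big1 // /edge_ind !eqxx [v2 == v1]eq_sym (negPf n3).
by rewrite (negPf n1).
Qed.

Lemma deficiencyD1 P j t : deficiency P t =
  (t - size_edges (P j)) + \sum_(i < k | i != j) (t - size_edges (P i)).
Proof. by rewrite /deficiency (bigD1 j). Qed.

Lemma last_two P w v1 v2 : last_pair P w v1 v2 -> deficiency P 2 <= 2 ->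
  exists Q, completes P Q 2 2.
Proof.
move=> lp def; have [sP n1 n2 n3 tot] := lp.
have others j i : i != j -> 2 - size_edges (P i) <= 2 - (2 - size_edges (P j)).
  move=> ij; move: def; rewrite (deficiencyD1 P j) (bigD1 i) //=; lia.
have e21 : edge_ind w v2 w v1 = 0.
  by rewrite /edge_ind eqxx [v2 == v1]eq_sym (negPf n3) (negPf n1).
have e12 : edge_ind w v1 w v2 = 0.
  by rewrite /edge_ind eqxx (negPf n3) (negPf n2).
have e11 u v : edge_ind u v u v = 1 by rewrite /edge_ind !eqxx.
have row2 i : mult (P i) w v1 + mult (P i) w v2 <= \sum_(x < N) mult (P i) w x.
  by rewrite (bigD1 v1) //= (bigD1 v2) 1?eq_sym //= addnA leq_addr.
have size2 i : mult (P i) w v1 + mult (P i) w v2 <= size_edges (P i).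
  have := mult_row_pair (sP i) n1; have := row2 i.
  by have := mult_le_row (P i) v1 w; rewrite multC; lia.
(* An empty class carries the whole deficiency and takes both edges, as the path v1 w v2. *)
have [/existsP[j /eqP s0]|no0] := boolP [exists j, size_edges (P j) == 0].
  have [P1 pl1] : exists P1, places P P1 j w v1.
    by apply: place => //; apply: unblocked_sparse => //; have := size2 j; lia.
  have [sP1 _ m1] := pl1.
  have [P2 pl2] : exists P2, places P1 P2 j w v2.
    apply: place => //; apply: unblocked_sparse => //.
      by rewrite (places_size j sP n1 pl1) s0 eqxx.
    by rewrite m1 e12 muln0; have := size2 j; lia.
  apply: (finish_two lp pl1 pl2) => i.
  rewrite (places_size i sP1 n2 pl2) (places_size i sP n1 pl1).
  by have [->|ij] := eqVneq i j; [lia | have := others j i ij; lia].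
have {no0} pos i : 0 < size_edges (P i).
  by rewrite lt0n; move: no0; rewrite negb_exists => /forallP.
have [d0|] := posnP (deficiency P 2).
  have sz := deficiency0 d0.
  have [Ew E1 _] := last_pair_ends lp.
  have [j nb] : exists j, ~~ blocked (P j) w v1.
    case: (unblocked_or P w v1) => // /all_blocked_ends; rewrite Ew E1; lia.
  have sz' i : 2 <= size_edges (P i) + (i == j) by have := sz i; lia.
  have [/andP[le _]|nb2] := boolP (blocked (P j) w v2).
    exact: last_two_then lp nb le sz'.
  exact: last_two_unblocked lp nb nb2 sz'.
rewrite lt0n sum_nat_eq0 => /forallPn[j]; rewrite subn_eq0 -ltnNge => lt.
have sj : size_edges (P j) = 1 by have := pos j; lia.
have sparse i v : w != v -> size_edges (P i) <= 1 -> mult (P i) w v = 0 -> ~~ blocked (P i) w v.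
  by move=> wv; apply: unblocked_sparse.
have [/existsP[j' /andP[jj lt']]|none] := boolP [exists j', (j' != j) && (size_edges (P j') < 2)].
  have sj' : size_edges (P j') = 1 by have := pos j'; lia.
  have big i : i != j -> i != j' -> 2 <= size_edges (P i).
    move=> ij ij'; move: def; rewrite (deficiencyD1 P j) (bigD1 j') //= (bigD1 i) /= ?ij //.
    lia.
  have two v v' i i' : last_pair P w v v' -> i != i' ->
      size_edges (P i) = 1 -> size_edges (P i') = 1 ->
      (forall h, h != i -> h != i' -> 2 <= size_edges (P h)) ->
      mult (P i) w v = 0 -> mult (P i') w v' = 0 -> exists Q, completes P Q 2 2.
    move=> lpv ii si si' bigs m0 m0'; have [_ nv nv' _ _] := lpv.
    have [P1 pl1] : exists P1, places P P1 i w v.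
      by apply: place => //; apply: sparse => //; rewrite si.
    have [sP1 eqP1 _] := pl1.
    have [P2 pl2] : exists P2, places P1 P2 i' w v'.
      apply: place => //; rewrite eqP1 1?eq_sym //; apply: sparse => //; by rewrite si'.
    apply: (finish_two lpv pl1 pl2) => h.
    rewrite (places_size h sP1 nv' pl2) (places_size h sP nv pl1).
    have [->|hi] := eqVneq h i; first by rewrite si.
    have [->|hi'] := eqVneq h i'; first by rewrite si'.
    by rewrite -addnA; apply: leq_trans (bigs h hi hi') (leq_addr _ _).
  (* Each of w v1, w v2 occurs in at most one of the two one-edge classes, and each of these classes
     contains at most one of them; so the two edges can be matched to the two classes without
     repetition. *)
  have tot1 v : w != v -> total P w v = 1 -> mult (P j) w v + mult (P j') w v <= 1.
    by move=> wv <-; rewrite /total (bigD1 j) //= (bigD1 j') //= addnA leq_addr.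
  have t1 : total P w v1 = 1 by have := tot w v1 n1; rewrite e11 e21; lia.
  have t2 : total P w v2 = 1 by have := tot w v2 n2; rewrite e11 e12; lia.
  have := tot1 v1 n1 t1; have := tot1 v2 n2 t2; have := size2 j; have := size2 j'.
  rewrite sj sj' => h1 h2 h3 h4.
  have [[m0 m0']|[m0 m0']] : (mult (P j) w v1 = 0 /\ mult (P j') w v2 = 0) \/
      (mult (P j') w v1 = 0 /\ mult (P j) w v2 = 0) by lia.
    by apply: (two v1 v2 j j') => //; rewrite eq_sym.
  by apply: (two v1 v2 j' j) => // h ? ?; apply: big.
have sz i : 2 <= size_edges (P i) + (i == j).
  have [->|ij] := eqVneq i j; first by rewrite sj.
  move: none; rewrite negb_exists => /forallP/(_ i); rewrite ij /= -leqNgt; lia.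
(* Only class j is short, by one edge. If it already consists of w v1 or of w v2, it takes the other
   edge, and this bound lets [last_two_then] place the remaining one. *)
have endle v : w != v -> 0 < mult (P j) w v -> ends (P j) w + ends (P j) v <= 2.
  move=> wv; have := mult_le_row (P j) w v; have := mult_le_row (P j) v w.
  rewrite multC; have := path_system_deg w (sP j); have := path_system_deg v (sP j); lia.
have := size2 j; rewrite sj => le1.
have [m1|m1] := posnP (mult (P j) w v1); last first.
  have m2 : mult (P j) w v2 = 0 by lia.
  apply: (last_two_then (last_pairC lp) (sparse j v2 n2 _ m2) _ sz); first by rewrite sj.
  exact: endle.
have [m2|m2] := posnP (mult (P j) w v2); last first.
  apply: (last_two_then lp (sparse j v1 n1 _ m1) _ sz); first by rewrite sj.
  exact: endle.
by apply: (last_two_unblocked lp (sparse j v1 n1 _ m1) (sparse j v2 n2 _ m2) sz); rewrite sj.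
Qed.

Definition share (e e' : 'I_N * 'I_N) :=
  [|| e.1 == e'.1, e.1 == e'.2, e.2 == e'.1 | e.2 == e'.2].

(** Each edge except the last meets a later one; in particular the last two are adjacent. *)
Fixpoint linked (L : seq ('I_N * 'I_N)) :=
  if L is e :: s then (nilp s || has (share e) s) && linked s else true.

Lemma fill_linked (L : seq ('I_N * 'I_N)) P : path_systems P ->
  all (fun e => e.1 != e.2) L -> linked L -> 2 <= size L ->
  (forall u v, pcount L u v <= 1) ->
  (forall u v, u != v -> total P u v + pcount L u v = 2) ->
  deficiency P 2 <= size L ->
  exists Q, completes P Q 2 2.
Proof.
elim: L P => // -[u v] s IH P sP nL lk sz cnt tot def.
have /andP[/= uv nL'] := nL; have /andP[/= adj lk'] := lk.
have e11 a b : edge_ind a b a b = 1 by rewrite /edge_ind !eqxx.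
have [s1|s2] := leqP (size s) 1.
  case: s s1 nL nL' lk lk' sz cnt tot def adj {IH} =>
    [|[a b] [|]] // _ nL /= /andP[ab _] _ _ _ cnt tot def.
  have cnt' x y : edge_ind u v x y + (edge_ind a b x y + 0) <= 1 := cnt x y.
  have tot' x y : x != y ->
    total P x y + (edge_ind u v x y + (edge_ind a b x y + 0)) = 2 := @tot x y.
  have sym x y a' b' : edge_ind x y a' b' = edge_ind y x a' b' by rewrite edge_indC.
  have go w v1 v2 : w != v1 -> w != v2 ->
      (forall a' b', edge_ind u v a' b' = edge_ind w v1 a' b') ->
      (forall a' b', edge_ind a b a' b' = edge_ind w v2 a' b') ->
      exists Q, completes P Q 2 2.
    move=> n1 n2 h1 h2; apply: (@last_two P w v1 v2) => //; split=> //.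
      by apply/eqP => e; have := cnt' w v1; rewrite h1 h2 -e !e11.
    by move=> x y xy; rewrite -(tot' x y xy) h1 h2 addn0.
  rewrite orbF /share /= => /or4P[] /eqP e.
  - by apply: (go u v b) => //; rewrite ?e.
  - by apply: (go u v a) => // [|x y]; rewrite ?e 1?eq_sym // sym.
  - apply: (go v u b) => [||x y|x y]; first by rewrite eq_sym.
    + by rewrite e.
    + exact: sym.
    + by rewrite e.
  - apply: (go v u a) => [||x y|x y]; first by rewrite eq_sym.
    + by rewrite e eq_sym.
    + exact: sym.
    + by rewrite e sym.
have uvL : pcount ((u, v) :: s) u v = 1.
  by have := cnt u v; have := pcount_head s u v; lia.
have step j : ~~ blocked (P j) u v ->
    (size_edges (P j) < 2 \/ deficiency P 2 <= 1) -> exists Q, completes P Q 2 2.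
  move=> nb dj; have [P' pl] := place sP uv nb.
  have [Q cQ] : exists Q, completes P' Q 2 2.
    apply: IH => // [|a b|a b ab|]; first by case: pl.
    - by have := cnt a b; rewrite pcount_cons; lia.
    - by rewrite (places_total _ _ pl) -(tot a b ab) pcount_cons addnA.
    have := places_deficiency 2 sP uv pl; move: def dj => /=; lia.
  by exists Q; apply: completes_places pl cQ.
have [/existsP[j /andP[lt m0]]|no] :=
    boolP [exists j, (size_edges (P j) < 2) && (mult (P j) u v == 0)].
  apply: (step j); last by left.
  by apply: unblocked_sparse => //; apply/eqP.
(* Every short class now contains uv, hence is that edge alone, and only one copy of uv has been
   placed. *)
have def1 : deficiency P 2 <= 1.
  apply: (@leq_trans (total P u v)); last by have := tot u v uv; rewrite uvL; lia.
  apply: leq_sum => i _.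
  move: no; rewrite negb_exists => /forallP/(_ i).
  by have := mult_le_size_edges (sP i) uv; case: ltnP => /=; lia.
have [j nb] : exists j, ~~ blocked (P j) u v; last by apply: (step j) => //; right.
apply: exists_unblocked => //.
have := total_row u sP nL tot; have := total_row v sP nL tot.
have rowc w : \sum_(x < N) pcount ((u, v) :: s) w x =
    (u == w) + (v == w) + \sum_(x < N) pcount s w x.
  by rewrite -edge_ind_deg // -big_split.
(* The later edge meeting uv is the third missing unit: the degrees of u and v sum to at most 4(N -
   1) - 3, below 2k = 4N - 6. *)
have shared : 0 < \sum_(x < N) pcount s u x + \sum_(x < N) pcount s v x.
  have pos (e : 'I_N * 'I_N) : e \in s -> 0 < pcount s e.1 e.2.
    by move=> es; rewrite -has_count; apply/hasP; exists e => //=; rewrite !eqxx.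
  move: adj; case: s s2 {IH nL lk sz cnt tot def nL' lk' uvL step rowc} pos => // e0 s0 _ pos.
  case/orP => // /hasP[e es sh]; have := pos e es.
  have := leq_row (e0 :: s0) e.1 e.2; have := leq_row (e0 :: s0) e.2 e.1.
  rewrite [pcount _ e.2 e.1]pcountC.
  by move: sh => /or4P[] /eqP /= ->; lia.
rewrite !rowc !eqxx [v == u]eq_sym (negPf uv); lia.
Qed.

End LastTwo.

(** * The case n = 3 and m = 1 *)

Lemma size_edges_le N (P : seq (seq 'I_N)) : size_edges P <= (size (flatten P)).-1.
Proof.
rewrite /size_edges; elim: P => [|p P IH]; rewrite ?big_nil // big_cons /= size_cat.
by case: p => //= x p; lia.
Qed.

(** Here x counts the one-edge classes and r the missing copies for each edge of the triangle, with
    no empty class left. The choice is a class to extend, a different edge to put there, and the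
    certainty that Hall's condition at the third edge is not tight. *)
Lemma triangle_choice x0 x1 x2 r0 r1 r2 X :
  x0 + x1 + x2 = X -> X = r0 + r1 + r2 -> 0 < X -> r0 + x0 <= X -> r1 + x1 <= X -> r2 + x2 <= X ->
  (0 < x0 /\ 0 < r1 /\ r2 + x2 < X) \/ (0 < x0 /\ 0 < r2 /\ r1 + x1 < X) \/
  (0 < x1 /\ 0 < r0 /\ r2 + x2 < X) \/ (0 < x1 /\ 0 < r2 /\ r0 + x0 < X) \/
  (0 < x2 /\ 0 < r0 /\ r1 + x1 < X) \/ (0 < x2 /\ 0 < r1 /\ r0 + x0 < X).
Proof. lia. Qed.

Lemma ord3_cover (s t o t' : 'I_3) : s != t -> s != o -> t != o ->
  [|| t' == s, t' == t | t' == o].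
Proof.
by case: s => [[|[|[|]]]] // ?; case: t => [[|[|[|]]]] // ?;
   case: o => [[|[|[|]]]] // ?; case: t' => [[|[|[|]]]].
Qed.

Section Triangle.
Variables (k mu : nat).
Hypothesis hk : k.*2 = 3 * mu.
Implicit Types (P Q : 'I_k -> seq (seq 'I_3)) (t : 'I_3).

Definition opp_edge t : 'I_3 * 'I_3 := (ordS t, ord_pred t).

Lemma opp_edge_neq t : (opp_edge t).1 != (opp_edge t).2.
Proof. by case: t => [[|[|[|t]]] lt_t]. Qed.

Lemma opp_edge_ind t t' :
  edge_ind (opp_edge t).1 (opp_edge t).2 (opp_edge t').1 (opp_edge t').2 = (t == t').
Proof. by case: t => [[|[|[|t]]] lt_t] //; case: t' => [[|[|[|t']]] lt_t']. Qed.

Lemma opp_edge_surj (u v : 'I_3) : u != v ->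
  exists t, (u = (opp_edge t).1 /\ v = (opp_edge t).2) \/
            (v = (opp_edge t).1 /\ u = (opp_edge t).2).
Proof.
move=> uv; have lt3 : 3 - u - v < 3.
  by case: u uv => [[|[|[|u]]] lu] //; case: v => [[|[|[|v]]] lv].
(* The three vertices sum to 3, so this is the third one. *)
exists (Ordinal lt3).
case: u uv lt3 => [[|[|[|u]]] lu] //; case: v => [[|[|[|v]]] lv] // _ lt3;
  by [left; split; apply: val_inj | right; split; apply: val_inj].
Qed.

Definition opp_mult (R : seq (seq 'I_3)) t := mult R (opp_edge t).1 (opp_edge t).2.

Lemma big_ord3 (f : 'I_3 -> nat) :
  \sum_t f t = f (inord 0) + f (inord 1) + f (inord 2).
Proof.
rewrite !big_ord_recr big_ord0 /= add0n.
by congr (f _ + f _ + f _); apply: val_inj; rewrite /= inordK.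
Qed.

Lemma sum_ltn3 (f : 'I_3 -> 'I_3 -> nat) : (forall u v, f u v = f v u) ->
  \sum_(u < 3) \sum_(v < 3 | u < v) f u v = \sum_t f (opp_edge t).1 (opp_edge t).2.
Proof.
move=> fC; rewrite (eq_bigr _ (fun u _ => big_mkcond _ _)) /= !big_ord3 !inordK //=.
have S i j : i < 3 -> j < 3 -> i.+1 %% 3 = j -> ordS (inord i : 'I_3) = inord j.
  by move=> i3 j3 e; apply: val_inj; rewrite /= !inordK.
have Pr i j : i < 3 -> j < 3 -> (i + 3).-1 %% 3 = j -> ord_pred (inord i : 'I_3) = inord j.
  by move=> i3 j3 e; apply: val_inj; rewrite /= !inordK.
rewrite (S 0 1) // (S 1 2) // (S 2 0) // (Pr 0 2) // (Pr 1 0) // (Pr 2 1) //.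
by rewrite [f (inord 2) (inord 0)]fC; lia.
Qed.

Lemma size_edges_opp (R : seq (seq 'I_3)) : path_system R ->
  size_edges R = \sum_t opp_mult R t.
Proof.
move=> sR; rewrite -mult_sum ?path_system_uniq //; apply: sum_ltn3 => u v.
exact: multC.
Qed.

Lemma size_edges_le2 (R : seq (seq 'I_3)) : path_system R -> size_edges R <= 2.
Proof.
move=> sR; have := size_edges_le R.
by rewrite (perm_size sR) size_enum_ord.
Qed.

Definition opp_total P t := total P (opp_edge t).1 (opp_edge t).2.
Definition nempty P := \sum_(i < k) (size_edges (P i) == 0).
Definition nsingle P t := \sum_(i < k) (size_edges (P i) == 1) * opp_mult (P i) t.

(** A class on three vertices has two edge slots: free slots and placed edges together number 2k. *)
Lemma triangle_count P : path_systems P ->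
  2 * nempty P + \sum_t nsingle P t + \sum_t opp_total P t = 3 * mu.
Proof.
move=> sP; rewrite /nempty /nsingle big_distrr exchange_big /=.
rewrite /opp_total /total [X in _ + X]exchange_big /= -!big_split /= -hk.
rewrite (eq_bigr (fun _ => 2)) ?sum_nat_const ?card_ord ?muln2 // => i _.
rewrite -big_distrr /= -(size_edges_opp (sP i)).
by have := size_edges_le2 (sP i); case: (size_edges (P i)) => [|[|[|n]]].
Qed.

Lemma places_opp P P' j t : path_systems P ->
  places P P' j (opp_edge t).1 (opp_edge t).2 ->
  [/\ path_systems P',
      forall i, size_edges (P' i) = size_edges (P i) + (i == j),
      forall i t', opp_mult (P' i) t' = opp_mult (P i) t' + (i == j) * (t == t') &
      forall t', opp_total P' t' = opp_total P t' + (t == t')].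
Proof.
move=> sP pl; have [sP' _ h] := pl; split=> // [i|i t'|t'].
- exact: places_size sP (opp_edge_neq t) pl.
- by rewrite /opp_mult h opp_edge_ind.
by rewrite /opp_total (places_total _ _ pl) opp_edge_ind.
Qed.

Lemma nsum_gt0 (I : finType) (f : I -> nat) : 0 < \sum_i f i -> exists i, 0 < f i.
Proof.
rewrite lt0n sum_nat_eq0 => /forallPn[i h]; exists i; by rewrite lt0n.
Qed.

(* The last hypothesis is Hall's condition for assigning the missing edges to the classes
   with fewer than two edges; it survives a suitable single assignment. *)
Lemma fill_triangle_all P : path_systems P ->
  (forall t, opp_total P t <= mu) ->
  (forall t, mu - opp_total P t + nsingle P t
               <= nempty P + \sum_t' nsingle P t') ->
  exists Q, completes P Q mu 0.
Proof.
have [n] := ubnP (\sum_t (mu - opp_total P t)); elim: n P => // n IH P lt_n sP tle inv.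
have cnt := triangle_count sP.
have step j t : opp_total P t < mu -> size_edges (P j) <= 1 -> opp_mult (P j) t = 0 ->
    (forall P', places P P' j (opp_edge t).1 (opp_edge t).2 ->
      forall t', mu - opp_total P' t' + nsingle P' t'
                 <= nempty P' + \sum_t'' nsingle P' t'') ->
    exists Q, completes P Q mu 0.
  move=> tlt s1 m0 inv'.
  have [P' pl] := place sP (opp_edge_neq t) (unblocked_sparse (sP j) (opp_edge_neq t) s1 m0).
  have [sP' _ _ tot'] := places_opp sP pl.
  have [Q cQ] : exists Q, completes P' Q mu 0.
    apply: IH => //; last 1 first.
    - exact: inv'.
    - move: lt_n; rewrite ltnS; apply: leq_trans; rewrite (bigD1 t) //= [X in _ <= X](bigD1 t) //=.
      apply: (@leq_trans ((mu - opp_total P t) + \sum_(i < 3 | i != t) (mu - opp_total P' i))).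
        by rewrite ltn_add2r tot' eqxx; lia.
      rewrite leq_add2l; apply: leq_sum => i _; rewrite tot'; lia.
    - move=> t'; rewrite tot'; have := tle t'; case: eqP => [<-|_]; lia.
  by exists Q; apply: completes_places pl cQ.
have nemptyE P' j t : places P P' j (opp_edge t).1 (opp_edge t).2 ->
    nempty P = nempty P' + (size_edges (P j) == 0).
  move=> pl; have [_ sz _ _] := places_opp sP pl.
  rewrite /nempty (bigD1 j) //= [X in _ = X + _](bigD1 j) //= sz eqxx addn1 add0n addnC.
  by congr (_ + _); apply: eq_bigr => i /negPf ij; rewrite sz ij addn0.
have nsingleE P' j t t' : places P P' j (opp_edge t).1 (opp_edge t).2 ->
    nsingle P t' + (size_edges (P j) == 0) * (t == t') =
    nsingle P' t' + (size_edges (P j) == 1) * opp_mult (P j) t'.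
  move=> pl; have [sP' sz mE _] := places_opp sP pl.
  rewrite /nsingle (bigD1 j) //= [X in _ = X + _](bigD1 j) //= sz mE eqxx addn1 mul1n.
  have -> : \sum_(i < k | i != j) (size_edges (P' i) == 1) * opp_mult (P' i) t' =
      \sum_(i < k | i != j) (size_edges (P i) == 1) * opp_mult (P i) t'.
    by apply: eq_bigr => i /negPf ij; rewrite sz mE ij !addn0.
  have : size_edges (P j) = 0 -> opp_mult (P j) t' = 0.
    by move=> s0; apply/eqP; rewrite -leqn0 -s0; apply: mult_le_size_edges (opp_edge_neq _).
  move: (\sum_(i < k | _) _) => S.
  by case: (size_edges (P j)) => [/(_ erefl) ->|[|m] _]; rewrite /= ?mul1n; lia.
have [r0|rpos] := posnP (\sum_t (mu - opp_total P t)).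
  exists P; split=> // u v uv.
  have full t : opp_total P t = mu.
    move/eqP: r0; rewrite sum_nat_eq0 => /forallP/(_ t) /=.
    by rewrite subn_eq0 => h; apply/eqP; rewrite eqn_leq tle.
  have [t [[-> ->]|[-> ->]]] := opp_edge_surj uv; first exact: full.
  rewrite -(full t); apply: eq_bigr => i _; exact: multC.
(* Filling an empty class with t trades one unit of [nempty] for one of [nsingle] at t, and one
   missing copy of t likewise, so neither side of Hall's condition changes. *)
have [z0|zpos] := posnP (nempty P); last first.
  have [t rt] := nsum_gt0 rpos; have [j] := nsum_gt0 zpos.
  case: eqP => // sj _.
  have mj t' : opp_mult (P j) t' = 0.
    by apply/eqP; rewrite -leqn0 -sj; apply: mult_le_size_edges (opp_edge_neq _).
  apply: (step j t); rewrite ?sj //; first by rewrite -subn_gt0.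
  move=> P' pl t'; have [_ _ _ tot'] := places_opp sP pl.
  have := nemptyE _ _ _ pl; have := inv t'; rewrite tot' sj eqxx.
  have nE t'' : nsingle P' t'' = nsingle P t'' + (t == t'').
    by have := nsingleE _ _ _ t'' pl; rewrite sj mj muln0 addn0 mul1n.
  under [\sum_t'' nsingle P' t'']eq_bigr do rewrite nE.
  rewrite big_split /= nE.
  have -> : \sum_(t'' < 3) (t == t'') = 1.
    by rewrite (bigD1 t) //= eqxx big1 // => i; rewrite eq_sym => /negPf ->.
  case: eqP => [<-|_]; last lia.
  by have := rt; lia.
have inv0 t := inv t; rewrite !z0 in cnt inv0.
pose o0 : 'I_3 := inord 0; pose o1 : 'I_3 := inord 1; pose o2 : 'I_3 := inord 2.
have dist i j : i < 3 -> j < 3 -> i != j -> (inord i : 'I_3) != inord j.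
  by move=> i3 j3; apply: contra => /eqP /(congr1 val) /=; rewrite !inordK // => ->.
(* Adding t to a class consisting of s lowers the right side by one, and the left side at s and at t
   by one; only at the third edge o is strictness needed beforehand. *)
have [s [t [o [xs rt ro [st so to]]]]] : exists s t o,
    [/\ 0 < nsingle P s, opp_total P t < mu,
        mu - opp_total P o + nsingle P o < \sum_t' nsingle P t' &
        [/\ s != t, s != o & t != o]].
  have := inv0 o0; have := inv0 o1; have := inv0 o2.
  have := tle o0; have := tle o1; have := tle o2.
  move: cnt rpos; rewrite !big_ord3 -/o0 -/o1 -/o2 => cnt rpos t2 t1 t0.
  rewrite !add0n => i2 i1 i0.
  have pick s t o : s != t -> s != o -> t != o -> 0 < nsingle P s -> 0 < mu - opp_total P t ->
      mu - opp_total P o + nsingle P o < nsingle P o0 + nsingle P o1 + nsingle P o2 ->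
      exists s t o, [/\ 0 < nsingle P s, opp_total P t < mu,
        mu - opp_total P o + nsingle P o < nsingle P o0 + nsingle P o1 + nsingle P o2 &
        [/\ s != t, s != o & t != o]].
    by rewrite subn_gt0 => *; exists s, t, o.
  have XE : nsingle P o0 + nsingle P o1 + nsingle P o2 =
      (mu - opp_total P o0) + (mu - opp_total P o1) + (mu - opp_total P o2).
    by move: cnt t2 t1 t0; clear; lia.
  have X0 : 0 < nsingle P o0 + nsingle P o1 + nsingle P o2 by rewrite XE.
  case: (triangle_choice erefl XE X0 i0 i1 i2) => [[? [? ?]]|].
    by apply: (pick o0 o1 o2); rewrite ?dist.
  case=> [[? [? ?]]|]; first by apply: (pick o0 o2 o1); rewrite ?dist.
  case=> [[? [? ?]]|]; first by apply: (pick o1 o0 o2); rewrite ?dist.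
  case=> [[? [? ?]]|]; first by apply: (pick o1 o2 o0); rewrite ?dist.
  case=> [[? [? ?]]|[? [? ?]]]; first by apply: (pick o2 o0 o1); rewrite ?dist.
  by apply: (pick o2 o1 o0); rewrite ?dist.
have [j] := nsum_gt0 xs; rewrite muln_gt0 lt0b => /andP[/eqP sj ms].
have [mt mo] : opp_mult (P j) t = 0 /\ opp_mult (P j) o = 0.
  have := size_edges_opp (sP j); rewrite sj (bigD1 s) //= (bigD1 t) 1?eq_sym //=.
  rewrite (bigD1 o) /=; last by rewrite ![o == _]eq_sym so.
  by move: ms; lia.
have {}ms : opp_mult (P j) s = 1.
  by have := mult_le_size_edges (sP j) (opp_edge_neq s); rewrite sj -/(opp_mult _ _); lia.
apply: (step j t); rewrite ?sj // => P' pl t'.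
have [_ _ _ tot'] := places_opp sP pl.
have nz : nempty P' = 0 by have := nemptyE _ _ _ pl; rewrite z0 sj; lia.
have nE t'' : nsingle P t'' = nsingle P' t'' + (t'' == s).
  have := nsingleE _ _ _ t'' pl; rewrite sj /= mul1n addn0 => ->; congr (_ + _).
  have /or3P[] := ord3_cover t'' st so to => /eqP ->; rewrite ?ms ?mt ?mo ?eqxx //.
    by rewrite eq_sym (negPf st).
  by rewrite eq_sym (negPf so).
have sumE : \sum_t'' nsingle P t'' = \sum_t'' nsingle P' t'' + 1.
  rewrite (eq_bigr _ (fun t'' _ => nE t'')) big_split /=; congr (_ + _).
  by rewrite (bigD1 s) //= eqxx big1 // => i /negPf ->.
rewrite nz add0n tot'; have := inv0 t'; rewrite sumE; move: ro; rewrite sumE.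
have /or3P[] := ord3_cover t' st so to => /eqP ->; rewrite !nE ?eqxx.
- by rewrite [t == s]eq_sym (negPf st); lia.
- by rewrite [t == s]eq_sym (negPf st); lia.
by rewrite (negPf to) [o == s]eq_sym (negPf so); lia.
Qed.

(** All 3 mu = 2k edges are placed and no class holds more than two, so each holds exactly two. *)
Lemma fill_triangle P : path_systems P ->
  (forall t, opp_total P t <= mu) ->
  (forall t, mu - opp_total P t + nsingle P t
               <= nempty P + \sum_t' nsingle P t') ->
  exists Q, completes P Q mu 2.
Proof.
move=> sP tle inv; have [Q [sQ leQ totQ _]] := fill_triangle_all sP tle inv.
exists Q; split=> // i.
suff -> : size_edges (Q i) = 2 by [].
apply: (eq_leq_sum (fun i => size_edges_le2 (sQ i))).
rewrite sum_nat_const card_ord muln2 hk.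
rewrite (eq_bigr (fun i => \sum_t opp_mult (Q i) t)) => [|j _]; last first.
  exact: size_edges_opp.
rewrite exchange_big /= -[3 in leqLHS](card_ord 3) -sum_nat_const.
by apply: leq_sum => t _; rewrite -(totQ _ _ (opp_edge_neq t)).
Qed.

End Triangle.

(** * Necessity *)

Lemma zip_rot (T U : Type) i (s : seq T) (t : seq U) : size s = size t ->
  rot i (zip s t) = zip (rot i s) (rot i t).
Proof.
move=> e; rewrite /rot zip_cat ?size_drop ?e //; congr (_ ++ _).
  by elim: i s t e => [|i IH] [|x s] [|y t] //= [e]; rewrite ?drop0 // IH.
by elim: i s t e => [|i IH] [|x s] [|y t] //= [e]; rewrite ?take0 // IH.
Qed.

Section Cycles.
Variable N : nat.
Implicit Types (s : seq 'I_N) (u v : 'I_N) (G : mgraph N).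

Lemma cycle_at s u : perm_eq s (enum 'I_N) -> 1 < N ->
  exists p, [/\ uniq (u :: p), (size p).+1 = N &
    forall v, v != u -> pcount (cycle_pairs s) u v =
      (ohead p == Some v) + (ohead (rev p) == Some v)].
Proof.
move=> ps N1; have us : uniq s by rewrite (perm_uniq ps) enum_uniq.
have su : u \in s by rewrite (perm_mem ps) mem_enum.
case/rot_to: su => i p E.
have rotE v : pcount (cycle_pairs s) u v = pcount (cycle_pairs (u :: p)) u v.
  rewrite -E /cycle_pairs rot_rot -zip_rot ?size_rot //.
  by rewrite pcount_rot.
have up : uniq (u :: p) by rewrite -E rot_uniq.
have sp : (size p).+1 = N.
  by rewrite -[LHS]/(size (u :: p)) -E size_rot (perm_size ps) size_enum_ord.
exists p; split=> // v vu.
rewrite rotE cycle_pairs_cons linkC !link_end // pmult_notin; last by case/andP: up.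
have : p != [::] by apply: contraTneq N1 => p0; rewrite -sp p0.
by case: p {sp E up rotE} => // *; rewrite !addn0.
Qed.

Lemma cycle_deg s u : perm_eq s (enum 'I_N) -> 1 < N ->
  \sum_(v < N | v != u) pcount (cycle_pairs s) u v = 2.
Proof.
move=> ps N1; have [p [up sp cE]] := cycle_at u ps N1.
rewrite (eq_bigr _ cE) big_split /=.
have one q : 0 < size q -> u \notin q -> \sum_(v < N | v != u) (ohead q == Some v) = 1.
  case: q => // x q _; rewrite inE negb_or => /andP[ux _].
  rewrite (bigD1 x) 1?eq_sym //= eqxx big1 // => v /andP[_ vx].
  by rewrite [_ == _]eq_sym; apply/eqP; rewrite eqb0; apply: contra vx => /eqP[->].
have un : u \notin p by case/andP: up.
have p0 : 0 < size p by rewrite -ltnS sp.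
by rewrite !one ?mem_rev ?size_rev.
Qed.

Lemma cycle_simple s u v : perm_eq s (enum 'I_N) -> 2 < N -> u != v ->
  pcount (cycle_pairs s) u v <= 1.
Proof.
move=> ps N2 uv; have [p [up sp cE]] := cycle_at u ps (ltnW N2).
rewrite cE 1?eq_sym //.
have : 1 < size p by rewrite -ltnS sp.
case: p up sp {cE} => [|x [|y p]] // up sp _.
case: eqP => [[xv]|_]; last by case: eqP.
case: eqP => // h.
have : v \in rev (y :: p).
  by move: h; rewrite ohead_rev_cons /=; exact: ohead_mem.
by rewrite mem_rev xv => xy; move: up; rewrite /= xy andbF.
Qed.

End Cycles.

Section Necessity.

Lemma eq_sum_lt n : \sum_(u < n) \sum_(v < n | u < v) 1 = 'C(n, 2).
Proof.
pose f (a b : 'I_n) : nat := a != b.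
have fC a b : f a b = f b a by rewrite /f eq_sym.
have f0 a : f a a = 0 by rewrite /f eqxx.
have e : \sum_(a < n) \sum_(b < n) f a b = n * n.-1.
  rewrite (eq_bigr (fun _ => n.-1)) ?sum_nat_const ?card_ord // => a _.
  rewrite (bigD1 a) //= f0 (eq_bigr (fun _ => 1)) => [|b]; last by rewrite /f eq_sym => ->.
  rewrite sum1_card add0n; have := cardC1 a; rewrite card_ord => <-; exact: eq_card.
rewrite bin2 -e (sum_ltn_sym fC f0) doubleK; apply: eq_bigr => a _.
by apply: eq_bigr => b ab; rewrite /f neq_ltn ab.
Qed.

Lemma decomposition_nedges n k lam (D : 'I_k -> mgraph n) : decomposition lam D ->
  \sum_(i < k) nedges (D i) = lam * 'C(n, 2).
Proof.
case=> _ tot; rewrite /nedges exchange_big /= -eq_sum_lt big_distrr.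
apply: eq_bigr => u _; rewrite exchange_big big_distrr /=; apply: eq_bigr => v uv.
by rewrite muln1 tot // neq_ltn uv.
Qed.

Lemma pair_le_nedges n (G : mgraph n) u v : is_mgraph G -> u != v ->
  G u v <= nedges G.
Proof.
case=> GC _; wlog lt_uv : u v / u < v => [H uv|_].
  have := uv; rewrite -(inj_eq val_inj) neq_ltn => /orP[lt|lt]; first exact: H.
  by rewrite GC; apply: H; rewrite // eq_sym.
by rewrite /nedges (bigD1 u) //= (bigD1 v) //= -addnA leq_addr.
Qed.

Lemma nedges_le_pair n (G K : mgraph n) u v : is_mgraph G -> is_mgraph K ->
  (forall a b, G a b <= K a b) -> u != v ->
  nedges G + K u v <= nedges K + G u v.
Proof.
move=> [GC G0] [KC K0] GK uv; pose D : mgraph n := fun a b => K a b - G a b.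
have mD : is_mgraph D by split=> [a b|a]; rewrite /D ?K0 // GC KC.
have -> : nedges K = nedges D + nedges G.
  rewrite /nedges -big_split; apply: eq_bigr => a _.
  by rewrite -big_split; apply: eq_bigr => b _ /=; rewrite subnK.
have := pair_le_nedges mD uv; rewrite /D; have := GK u v; lia.
Qed.

Lemma nedges_le n (G K : mgraph n) : (forall a b, G a b <= K a b) -> nedges G <= nedges K.
Proof. by move=> GK; apply: leq_sum => a _; apply: leq_sum => b _. Qed.

Lemma S_cardE n k (A : 'I_k -> mgraph n) j :
  S_card A j = \sum_(i < k) (nedges (A i) == j).
Proof.
rewrite /S_card -sum1_card big_mkcond; apply: eq_bigr => i _.
by rewrite inE; case: eqP.
Qed.

Lemma S1_cardE n k (A : 'I_k -> mgraph n) u v :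
  S1_card A u v = \sum_(i < k) ((nedges (A i) == 1) && (A i u v == 1)).
Proof.
rewrite /S1_card -sum1_card big_mkcond; apply: eq_bigr => i _.
by rewrite inE; case: (_ && _).
Qed.

Lemma nedges_size_edges n (G : mgraph n) R : path_system R ->
  (forall u v, u != v -> G u v = mult R u v) -> nedges G = size_edges R.
Proof.
move=> sR GR; rewrite -mult_sum ?path_system_uniq //; apply: eq_bigr => u _.
by apply: eq_bigr => v uv; apply: GR; rewrite neq_ltn uv.
Qed.

(** Truncated subtraction discards the classes with more than d edges. For d = 0 only the term j = 0
    is left, with coefficient 0, which agrees with the empty sum. *)
Lemma sum_S_card n k (A : 'I_k -> mgraph n) d :
  \sum_(j < d.+1) (d - j) * S_card A j = \sum_(i < k) (d - nedges (A i)).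
Proof.
under eq_bigr do rewrite S_cardE big_distrr.
rewrite exchange_big; apply: eq_bigr => i _ /=.
have [le|lt] := leqP (nedges (A i)) d; last first.
  rewrite big1 => [|j _]; first by apply/esym/eqP; rewrite subn_eq0 ltnW.
  have := ltn_ord j; case: eqP => [e|_]; rewrite ?muln0 // -e; lia.
rewrite (bigD1 (inord (nedges (A i)))) //= inordK ?ltnS // eqxx muln1.
rewrite big1 ?addn0 // => j nj; case: eqP => [e|_]; rewrite ?muln0 //.
by case/eqP: nj; apply: val_inj; rewrite /= inordK ?ltnS.
Qed.

Lemma lez_natE d C x y : 0 < C ->
  (x%:Z <= d%:Z * (C%:Z - 1) - y%:Z)%R = (x + y <= d * (C - 1)).
Proof.
by move=> C0; rewrite lerBrDr -PoszD -[1%R]/(Posz 1) subzn // -PoszM.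
Qed.

Lemma ham_deg N (G : mgraph N) u : ham_cycle G -> \sum_(v < N) G u v = 2.
Proof.
case=> [[_ G0] [N1 [s [ps GE]]]]; rewrite (bigD1 u) //= G0 add0n.
rewrite -(cycle_deg u ps N1); apply: eq_bigr => v vu; apply: GE.
by rewrite eq_sym.
Qed.

Variables (n m mu lam k : nat).
Variables (A : 'I_k -> mgraph n) (H : 'I_k -> mgraph (n + m)).
Hypotheses (decA : decomposition lam A) (hamH : ham_decomposition mu H).
Hypothesis AH : forall i u v, A i u v <= H i (lshift m u) (lshift m v).

Let B i : mgraph n := fun u v => H i (lshift m u) (lshift m v).

Lemma enclosed_size : 0 < n -> k.*2 = mu * (m + n - 1).
Proof.
move=> hn; have [[_ tot] ham] := hamH; pose u := lshift m (Ordinal hn).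
have : \sum_(i < k) \sum_(v < n + m) H i u v = k.*2.
  rewrite (eq_bigr (fun _ => 2)) ?sum_nat_const ?card_ord ?muln2 // => i _.
  exact: ham_deg.
move=> <-; rewrite exchange_big (bigD1 u) //= big1 ?add0n => [|i _]; last first.
  by have [[_ ->] _] := ham i.
rewrite (eq_bigr (fun _ => mu)) => [|v vu]; last by rewrite tot // eq_sym.
rewrite sum_nat_const mulnC; congr (_ * _).
transitivity #|predC1 u|; first exact: eq_card.
by rewrite cardC1 card_ord addnC subn1.
Qed.

Lemma restriction_mgraph i : is_mgraph (B i).
Proof. by have [[mg _] _] := hamH; have [HC H0] := mg i; split=> *; rewrite /B ?H0. Qed.

Lemma restriction_decomposition : decomposition mu B.
Proof.
split=> [|u v uv]; first exact: restriction_mgraph.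
by have [[_ tot] _] := hamH; apply: tot; rewrite (inj_eq (@lshift_inj _ _)).
Qed.

(** The degrees of the n old vertices sum to 2n, and at most 2m of that goes to the new vertices,
    each of degree 2. *)
Lemma restriction_nedges i : n - m <= nedges (B i).
Proof.
have [_ ham] := hamH; have [BC B0] := restriction_mgraph i.
rewrite -leq_double /nedges -(sum_ltn_sym BC B0).
have : \sum_(u < n) (\sum_(v < n) B i u v + \sum_(w < m) H i (lshift m u) (rshift n w)) = n * 2.
  rewrite (eq_bigr (fun _ => 2)) ?sum_nat_const ?card_ord // => u _.
  by rewrite -(ham_deg (lshift m u) (ham i)) big_split_ord.
rewrite big_split /= -muln2 mulnBl leq_subLR => <-.
rewrite addnC leq_add2r.
rewrite exchange_big; apply: (@leq_trans (\sum_(w < m) 2)); last first.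
  by rewrite sum_nat_const card_ord.
apply: leq_sum => w _ /=.
rewrite -(ham_deg (rshift n w) (ham i)) big_split_ord /=.
apply: leq_trans (leq_addr _ _); apply: leq_sum => u _.
by have [[HC _] _] := ham i; rewrite HC.
Qed.

Lemma enclosed_deficiency :
  \sum_(i < (n - m).+1) (n - m - i) * S_card A i <= (mu - lam) * 'C(n, 2).
Proof.
rewrite sum_S_card mulnBl -(decomposition_nedges restriction_decomposition).
rewrite -(decomposition_nedges decA) leq_subRL; last first.
  by apply: leq_sum => i _; apply: nedges_le.
rewrite -big_split; apply: leq_sum => i _ /=.
have := restriction_nedges i; have := nedges_le (AH i : forall a b, A i a b <= B i a b); lia.
Qed.

(** A class equal to uv needs a further edge, and an empty class needs two; a Hamiltonian cycle on
    more than two vertices has at most one copy of uv. So each such class gains an edge other than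
    uv, and only (mu - lam)('C(n, 2) - 1) of these are available. *)
Lemma enclosed_single u v : n - m = 2 -> 2 < n + m -> lam <= mu -> u != v ->
  S1_card A u v + S_card A 0 <= (mu - lam) * ('C(n, 2) - 1).
Proof.
move=> nm N2 lm uv; have [mA totA] := decA; have [_ ham] := hamH.
have decB := restriction_decomposition.
have : \sum_(i < k) (((nedges (A i) == 1) && (A i u v == 1)) + (nedges (A i) == 0)
    + nedges (A i) + B i u v) <= \sum_(i < k) (nedges (B i) + A i u v).
  apply: leq_sum => i _.
  have B1 : B i u v <= 1.
    have [_ [_ [s [ps HE]]]] := ham i; rewrite /B HE ?(inj_eq (@lshift_inj _ _)) //.
    by apply: cycle_simple => //; rewrite (inj_eq (@lshift_inj _ _)).
  have := nedges_le_pair (mA i) (restriction_mgraph i) (AH i) uv.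
  have := restriction_nedges i; rewrite nm; have := pair_le_nedges (mA i) uv.
  case: (nedges (A i)) => [|[|a]] /=; [lia | | lia].
  by case: (A i u v) => [|[|b]] /=; lia.
rewrite !big_split /= -S_cardE -S1_cardE (decomposition_nedges decA) (decomposition_nedges decB).
rewrite (totA u v uv) (proj2 decB u v uv).
have C0 : 0 < 'C(n, 2) by rewrite bin_gt0; lia.
have [d ->] : exists d, mu = lam + d by exists (mu - lam); rewrite subnKC.
rewrite addKn mulnDl mulnBr muln1.
have : d <= d * 'C(n, 2) by rewrite leq_pmulr.
lia.
Qed.

End Necessity.

(** * Sufficiency *)

Lemma linear_forest_path_system n (G : mgraph n) : linear_forest G ->
  exists R, path_system R /\ forall u v, u != v -> G u v = mult R u v.
Proof.
case=> _ [P [uP GE]]; pose S := [seq [:: v] | v <- enum 'I_n & v \notin flatten P].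
have fS : flatten S = [seq v <- enum 'I_n | v \notin flatten P].
  by rewrite /S; elim: [seq _ <- _ | _] => //= v s ->.
exists (P ++ S); split.
  rewrite /path_system flatten_cat fS; apply: uniq_perm.
  - rewrite cat_uniq uP filter_uniq ?enum_uniq // andbT.
    by apply/hasPn => v; rewrite mem_filter => /andP[].
  - exact: enum_uniq.
  by move=> v; rewrite mem_cat mem_filter mem_enum andbT; case: (v \in flatten P).
move=> u v uv; rewrite GE // /mult big_cat /= [X in _ = _ + X]big_map.
by rewrite [X in _ = _ + X]big1 ?addn0.
Qed.

Lemma pmult_map n N (f : 'I_n -> 'I_N) (p : seq 'I_n) u v : injective f ->
  pmult (map f p) (f u) (f v) = pmult p u v.
Proof.
move=> fI; elim: p => // x p IH; rewrite map_cons !pmult_cons IH; congr (_ + _).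
by case: p {IH} => //= y p; rewrite /edge_ind !(inj_eq fI).
Qed.

Lemma enclose n m k mu (A : 'I_k -> mgraph n) (Q : 'I_k -> seq (seq 'I_n)) :
  0 < n -> 0 < m -> k.*2 = mu * (m + n - 1) ->
  (forall i, is_mgraph (A i)) ->
  (forall i u v, u != v -> A i u v <= mult (Q i) u v) ->
  path_systems Q -> (forall u v, u != v -> total Q u v = mu) ->
  (forall i, n - m <= size_edges (Q i)) ->
  enclosable_ham m mu A.
Proof.
move=> hn hm hk mA AQ sQ totQ szQ.
have fI : injective (@lshift n m) := @lshift_inj n m.
pose S i := [seq map (@lshift n m) p | p <- Q i & p != [::]].
(* [embed_cycles] asks for exactly m paths in each class. *)
pose P i := S i ++ nseq (m - size (S i)) [::].
pose R := [seq rshift n w | w <- enum 'I_m].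
have szS i : size (S i) <= m.
  have := size_edges_nonempty (Q i); rewrite (perm_size (sQ i)) size_enum_ord size_map => e.
  by rewrite -(leq_add2l (size_edges (Q i))) e addnC -leq_subLR.
have fP i : flatten (P i) = map (@lshift n m) (flatten (Q i)).
  rewrite /P flatten_cat [X in _ ++ X](_ : _ = [::]) ?cats0; last by elim: (m - _).
  by rewrite /S; elim: (Q i) => //= -[|x p] s IH //=; rewrite IH map_cat.
have multP i u v : mult (P i) (lshift m u) (lshift m v) = mult (Q i) u v.
  rewrite /mult /P big_cat /= [X in _ + X]big1_seq ?addn0; last first.
    by move=> p /andP[_ /nseqP[->]].
  rewrite big_map big_filter big_mkcond; apply: eq_bigr => -[|x p] _ //.
  by rewrite pmult_map.
have inR (x : 'I_(n + m)) : x \notin R -> exists u, x = lshift m u.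
  case: (splitP x) => [u e|w e] xR; first by exists u; apply: val_inj.
  case/negP: xR; apply/mapP; exists w; first by rewrite mem_enum.
  exact: val_inj.
have uR : uniq R by rewrite map_inj_uniq ?enum_uniq //; exact: rshift_inj.
have dec : decomposes mu P R.
  split=> // [i|x y xy /inR[u xE] /inR[v yE]]; last first.
    subst x y; rewrite -(totQ u v); last by apply: contra xy => /eqP ->.
    by apply: eq_bigr => i _; rewrite multP.
  apply: uniq_perm; rewrite ?enum_uniq //.
    rewrite cat_uniq uR fP map_inj_uniq // path_system_uniq // andbT.
    apply/hasPn => x /mapP[w _ ->]; apply/mapP => -[u _ /eqP].
    by rewrite eq_rlshift.
  move=> x; rewrite mem_enum mem_cat fP; case: (boolP (x \in R)) => [_|/inR[u ->]].
    by rewrite orbT.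
  by rewrite orbF mem_map // (perm_mem (sQ i)) mem_enum.
have szR : size R = m by rewrite size_map size_enum_ord.
have N1 : 1 < n + m by lia.
have hk' : k.*2 = mu * (n + m - 1) by rewrite hk addnC.
have [s [ps totS leS]] : exists s : 'I_k -> seq 'I_(n + m),
    [/\ forall i, perm_eq (s i) (enum 'I_(n + m)),
    forall u v, u != v -> \sum_(i < k) pcount (cycle_pairs (s i)) u v = mu &
    forall i u v, mult (P i) u v <= pcount (cycle_pairs (s i)) u v].
  apply: (embed_cycles N1 hk' dec).
    by rewrite -size_eq0 szR -lt0n.
  by move=> i; rewrite size_cat size_nseq szR subnKC.
pose H i : mgraph (n + m) := fun u v => if u == v then 0 else pcount (cycle_pairs (s i)) u v.
have mH i : is_mgraph (H i).
  by split=> [u v|u]; rewrite /H ?eqxx // eq_sym pcountC.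
exists H; split; last first.
  move=> i u v; rewrite /H (inj_eq fI); case: (eqVneq u v) => [->|uv].
    by have [_ ->] := mA i.
  by apply: leq_trans (AQ i u v uv) _; rewrite -multP.
split=> [|i]; first split=> // u v uv.
  by rewrite -(totS u v uv); apply: eq_bigr => i _; rewrite /H (negPf uv).
split=> //; split=> //; exists (s i); split=> // u v uv.
by rewrite /H (negPf uv).
Qed.

(** * The missing edges in lexicographic order, and the conclusion *)

Definition edges n : seq ('I_n * 'I_n) :=
  [seq e : 'I_n * 'I_n <- [seq (a, b) | a <- enum 'I_n, b <- enum 'I_n] | e.1 < e.2].

Lemma mem_edges n (e : 'I_n * 'I_n) : (e \in edges n) = (e.1 < e.2).
Proof.
rewrite mem_filter; case: ltnP => //= _; case: e => a b.
by rewrite allpairs_f ?mem_enum.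
Qed.

Lemma edges_uniq n : uniq (edges n).
Proof.
rewrite filter_uniq // allpairs_uniq ?enum_uniq // => -[a b] [c d] _ _ //.
Qed.

Lemma edges_neq n : all (fun e => e.1 != e.2) (edges n).
Proof. by apply/allP => e; rewrite mem_edges neq_ltn => ->. Qed.

Lemma pcount_edges n (u v : 'I_n) : u != v -> pcount (edges n) u v = 1.
Proof.
wlog lt_uv : u v / u < v => [H uv|_].
  have := uv; rewrite -(inj_eq val_inj) neq_ltn => /orP[lt|lt]; first exact: H.
  by rewrite pcountC; apply: H; rewrite // eq_sym.
transitivity (count_mem (u, v) (edges n)); last first.
  by rewrite count_uniq_mem ?edges_uniq // mem_edges lt_uv.
apply: eq_in_count => -[a b]; rewrite mem_edges /= xpair_eqE => lt_ab.
case: (eqVneq a v) => [av|_]; last by rewrite orbF.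
case: (eqVneq b u) => [bu|_]; rewrite ?orbF //.
by move: lt_ab; rewrite av bu; lia.
Qed.

Lemma size_edges_list n : size (edges n) = 'C(n, 2).
Proof.
rewrite -(pcount_sum (edges_neq n)) -eq_sum_lt.
by apply: eq_bigr => u _; apply: eq_bigr => v uv; rewrite pcount_edges // neq_ltn uv.
Qed.

Definition lexlt n (e f : 'I_n * 'I_n) :=
  (e.1 < f.1) || (e.1 == f.1) && (e.2 < f.2).

Lemma edges_sorted n : pairwise (@lexlt n) (edges n).
Proof.
apply: pairwise_filter.
have pw : pairwise (fun a b : 'I_n => a < b) (enum 'I_n).
  rewrite -(pairwise_map val ltn) val_enum_ord; rewrite -sorted_pairwise ?iota_ltn_sorted //.
  exact: ltn_trans.
have pairs s t : pairwise (fun a b : 'I_n => a < b) s ->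
    pairwise (fun a b : 'I_n => a < b) t -> pairwise (@lexlt n) [seq (a, b) | a <- s, b <- t].
  move=> ps pt; elim: s ps => //= a s IH /andP[/allP as_ /IH {}IH].
  rewrite pairwise_cat IH andbT; apply/andP; split.
    apply/allrelP => e f /mapP[b _ ->] /allpairsP[[c d] [cs _ ->]].
    by rewrite /lexlt /= as_.
  rewrite pairwise_map; apply: sub_pairwise pt => b c bc.
  by rewrite /lexlt /= eqxx bc orbT.
exact: (pairs _ _ pw pw).
Qed.

(** Upward closure passes to tails, so it carries the induction. If the next edge f does not start
    where e does, then the edge joining the first vertex of f to the second of e meets e and comes
    later, unless these vertices coincide and f itself meets e. *)
Lemma linked_upward n (L : seq ('I_n * 'I_n)) : pairwise (@lexlt n) L ->
  (forall e, e \in L -> e.1 < e.2) ->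
  (forall e f : 'I_n * 'I_n, e \in L -> f.1 < f.2 -> lexlt e f -> f \in L) -> linked L.
Proof.
elim: L => // e s IH /= /andP[/allP es ps] edge up.
have irr (f : 'I_n * 'I_n) : lexlt f f = false by rewrite /lexlt ltnn eqxx ltnn.
have up' (f g : 'I_n * 'I_n) : f \in s -> g.1 < g.2 -> lexlt f g -> g \in s.
  move=> fs lg fg; have := up f g (@mem_behead _ (e :: s) f fs) lg fg.
  rewrite inE => /orP[/eqP ge|//].
  have := es f fs; move: fg; rewrite ge /lexlt.
  by case: (eqVneq f.1 e.1) => [->|_]; rewrite ?ltnn ?eqxx /=; lia.
rewrite IH // ?andbT; last by move=> f fs; apply: edge; rewrite inE fs orbT.
case: s es {ps IH up'} up edge => // f s es up edge; rewrite /nilp orFb.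
have e12 : e.1 < e.2 by apply: edge; rewrite mem_head.
have f12 : f.1 < f.2 by apply: edge; rewrite inE mem_head orbT.
have ef : lexlt e f by apply: es; rewrite mem_head.
have found (g : 'I_n * 'I_n) : g.1 < g.2 -> lexlt e g -> share e g -> has (share e) (f :: s).
  move=> lg eg sh; apply/hasP; exists g => //.
  have := up e g (mem_head _ _) lg eg; rewrite inE => /orP[/eqP ge|//].
  by rewrite ge irr in eg.
case: (eqVneq e.1 f.1) => [e1|ne1]; first by apply: (found f) => //; rewrite /share e1 eqxx.
have lt1 : e.1 < f.1 by move: ef; rewrite /lexlt (negPf ne1) orbF.
case: (ltngtP f.1 e.2) => [lt|gt|/val_inj eq].
- by apply: (found (f.1, e.2)); rewrite /lexlt /share /= ?lt1 ?eqxx ?orbT.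
- by apply: (found (e.2, f.1)); rewrite /lexlt /share /= ?e12 ?eqxx ?orbT.
by apply: (found f) => //; rewrite /share eq eqxx !orbT.
Qed.

Lemma edges_linked n : linked (edges n).
Proof.
apply: linked_upward => [|e|e f _]; first exact: edges_sorted.
  by rewrite mem_edges.
by rewrite mem_edges => ->.
Qed.

(** By [triangle_count] the free slots number 3(mu - lam), which turns the (M3) bound 2(mu - lam)
    into Hall's condition of [fill_triangle]. *)
Lemma complete_on_triangle k (A : 'I_k -> mgraph 3) lam mu :
  lam < mu -> strong_path_decomposition lam A -> k.*2 = 3 * mu ->
  (forall u v, u != v -> S1_card A u v + S_card A 0 <= (mu - lam) * 2) ->
  forall P, path_systems P -> (forall i u v, u != v -> A i u v = mult (P i) u v) ->
  exists Q, completes P Q mu 2.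
Proof.
move=> lt_lam [[_ totA] linA] hk M3 P sP AP.
have szE i : nedges (A i) = size_edges (P i) := nedges_size_edges (sP i) (AP i).
have totE t : opp_total P t = lam.
  rewrite -(totA _ _ (opp_edge_neq t)); apply: eq_bigr => i _.
  by rewrite AP // opp_edge_neq.
have ltT t : opp_total P t <= mu by rewrite totE ltnW.
apply: fill_triangle => // t.
have cnt := triangle_count hk sP.
have zE : nempty P = S_card A 0.
  by rewrite S_cardE; apply: eq_bigr => i _; rewrite szE.
have xE : nsingle P t = S1_card A (opp_edge t).1 (opp_edge t).2.
  rewrite S1_cardE; apply: eq_bigr => i _; rewrite szE AP ?opp_edge_neq // -/(opp_mult _ _).
  have := mult_le_size_edges (sP i) (opp_edge_neq t); rewrite -/(opp_mult _ _).
  by case: eqP => [->|_] //=; case: (opp_mult _ _) => [|[|?]].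
have := M3 _ _ (opp_edge_neq t); rewrite -xE -zE.
move: cnt; rewrite (eq_bigr (fun _ => lam) (fun t' _ => totE t')).
rewrite sum_nat_const card_ord totE.
move: (\sum_t' nsingle P t') => X; lia.
Qed.

Unset Implicit Arguments.

Theorem theorem1 (n m mu lam k : nat)
  (hn : (0 < n)%N) (hm : (0 < m)%N) (hmu : (0 < mu)%N) (hlam : (0 < lam)%N)
  (hk : (0 < k)%N)
  (hcase : [/\ lam < mu & n - 1 <= m]%N \/
           [/\ lam = 1%N, mu = 2%N & m = (n - 2)%N] \/
           [/\ (lam < mu)%N, n = 3%N & m = 1%N])
  (A : 'I_k -> mgraph n) (hA : strong_path_decomposition lam A) :
  enclosable_ham m mu A <->
  [/\ (k.*2 = mu * (m + n - 1))%N,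
      (\sum_(i < (n - m).+1) (n - m - i) * S_card A i
         <= (mu - lam) * 'C(n, 2))%N
    & ([/\ lam = 1%N, mu = 2%N & m = (n - 2)%N] \/
       [/\ (lam < mu)%N, n = 3%N & m = 1%N]) ->
      forall u v : 'I_n, u != v ->
        ((S1_card A u v)%:Z <= (mu - lam)%:Z * ('C(n, 2)%:Z - 1)
                                 - (S_card A 0)%:Z)%R].
Proof.
have [decA linA] := hA; have [mA totA] := decA.
have lt_lam : lam < mu by case: hcase => [[]|[[-> ->]|[]]].
split=> [[H [hamH AH]]|[M1 M2 M3]].
  split.
  - exact: (enclosed_size hamH hn).
  - exact: (enclosed_deficiency decA hamH AH).
  move=> hc u v uv.
  (* Both exceptional cases have n - m = 2; in (ii), 2 < n because m is positive. *)
  have n3 : 2 < n /\ n - m = 2 by case: hc => [[_ _ e]|[_ -> ->]]; lia.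
  rewrite lez_natE ?bin_gt0 ?(ltnW (proj1 n3)) //.
  apply: (enclosed_single decA hamH AH) => //; lia.
have [P hP] := fin_all_exists (fun i => linear_forest_path_system (linA i)).
have sP : path_systems P by move=> i; have [] := hP i.
have AP i u v : u != v -> A i u v = mult (P i) u v by have [_ h] := hP i; apply: h.
have szE i : nedges (A i) = size_edges (P i) := nedges_size_edges (sP i) (AP i).
have totP u v : u != v -> total P u v = lam.
  by move=> uv; rewrite -(totA u v uv); apply: eq_bigr => i _; rewrite AP.
have def : deficiency P (n - m) <= (mu - lam) * size (edges n).
  rewrite size_edges_list; apply: leq_trans M2; rewrite sum_S_card.
  by apply: leq_sum => i _; rewrite szE.
suff [Q [sQ leQ totQ szQ]] : exists Q, completes P Q mu (n - m).
  by apply: (enclose hn hm M1 mA _ sQ totQ szQ) => i u v uv; rewrite AP.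
case: hcase => [[_ hnm]|[hc|hc]].
- pose L := flatten (nseq (mu - lam) (edges n)).
  have pL u v : pcount L u v = (mu - lam) * pcount (edges n) u v.
    rewrite /L; elim: (mu - lam) => //= d IH.
    by rewrite mulSn -IH /pcount count_cat.
  apply: (@fill_greedy n k mu (n - m) L) => //.
  + lia.
  (* This is where m >= n - 1 enters the degree count. *)
  + have : mu * (n - 1) + mu * (n - 1) <= k.*2 by rewrite M1 -mulnDr leq_mul2l; lia.
    lia.
  + by apply/allP => e /flattenP[s /nseqP[-> _]]; apply: (allP (edges_neq n)).
  + by move=> u v uv; rewrite totP // pL pcount_edges // muln1 subnKC // ltnW.
  by apply: leq_trans def _; rewrite /L size_flatten /shape map_nseq sumn_nseq mulnC.
- have [lam1 mu2 mE] := hc.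
  have n3 : 3 <= n by lia.
  have nm2 : n - m = 2 by lia.
  rewrite nm2 mu2 lam1 mul1n in def *.
  apply: (@fill_linked n k _ (edges n)) => //.
  + by move: M1; rewrite mu2; lia.
  + exact: edges_neq.
  + exact: edges_linked.
  + by rewrite size_edges_list; apply: leq_trans (leq_bin2l 2 n3).
  + move=> u v; case: (eqVneq u v) => [<-|uv]; last by rewrite pcount_edges.
    rewrite leqNgt; apply/negP => /ltnW; rewrite -has_count => /hasP[e].
    by rewrite mem_edges /= orbb => lt /andP[/eqP e1 /eqP e2]; rewrite e1 e2 ltnn in lt.
  by move=> u v uv; rewrite totP // pcount_edges // lam1.
have [_ n3 m1] := hc.
move: hn hk hm A M1 M2 M3 hA decA linA mA totA P hP sP AP szE totP def.
rewrite n3 m1 => _ _ _ A' M1' _ M3' hA' _ _ _ _ P' _ sP' AP' _ _ _.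
apply: (complete_on_triangle lt_lam hA') => //; first by rewrite M1' mulnC.
move=> u v uv; have := M3' (or_intror (And3 lt_lam erefl erefl)) u v uv.
by rewrite lez_natE.
Qed.
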